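(* Assume that $Z$ is a densely defined linear operator in a complete (Hausdorff) locally convex space $\mathbf{X}$ and $t>0$. Assume also that there exists a function $F\in\mathcal{F}_{\mathbf{X}}$ such that $\mathcal{D}(F'_{ef}(0))\supset\mathcal{D}(Z)$ and $F'_{ef}(0)g=Zg$ for $g\in\mathcal{D}(Z)$. Then the operator $Z$ possesses a closure and its closure is the generator of an $lC_0$-semigroup if and only if there exists a dense linear subspace $\mathbf{A}\subseteq\mathcal{D}(Z)$ of $\mathbf{X}$ such that for any $f\in\mathbf{A}$ and $s\ge0$ there exists a sequence $\{f_n^s\}_{n=1}^\infty$, $f_n^s\in\mathcal{D}(\overline{Z})$, satisfying the following conditions: (a) $w\text{-}\lim_{n\to\infty}\left(F(\tfrac tn)^{[ns]}f-f_n^s\right)=0$; (b) every subsequence of the sequence $\{F(\tfrac tn)^{[ns/t]}f\}_{n\in\mathbb{N}}$ has a convergent subsequence; (c) every subsequence of the sequence $\{\overline{Z}f_n^s\}_{n=1}^\infty$ has a weakly convergent subsequence.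
   Context: $\mathbf{X}$ is over $\mathbb{T}\in\{\mathbb{R},\mathbb{C}\}$ with topology generated by semi-norms $\|\cdot\|_\alpha$, $\alpha\in\Omega$. $\mathcal{L}(\mathbf{X})$ is the space of bounded linear operators in $\mathbf{X}$ with the topology of pointwise convergence; $I$ is the identity; $\mathcal{D}(C)$ is the domain of $C$; $[\cdot]$ is the integer part; $w\text{-}\lim$ is the limit in the weak topology $\sigma(\mathbf{X},\mathbf{X}^* )$. A family $G_\beta\in\mathcal{L}(\mathbf{X})$, $\beta\in\Gamma$, is equicontinuous if for any $\alpha\in\Omega$ there are finitely many $\alpha_1,\dots,\alpha_n\in\Omega$ and $b_1,\dots,b_n>0$ with $\sup_\beta\|G_\beta x\|_\alpha\le\sum_i b_i\|x\|_{\alpha_i}$ for all $x\in\mathbf{X}$. For $F:[0,\infty)\to\mathcal{L}(\mathbf{X})$ and $s\ge0$ put $\mathbf{B}^F_s=\{F(\tfrac dn)^m : md/n\le s,\ n,m\in\mathbb{N},\ d\ge0\}$. $\mathcal{E}_{\mathbf{X}}$ is the set of $F:[0,\infty)\to\mathcal{L}(\mathbf{X})$ with $F(0)=I$ and $\mathbf{B}^F_s$ equicontinuous for every $s\ge0$. Many-valued effective derivative: $\mathcal{D}(F'_{mef}(0))$ is the set of $f\in\mathbf{X}$ for which there is a family $\{f_s\}_{s\ge0}$ in $\mathbf{X}$ such that $\lim_{h\to0}f_h=f$ and $\lim_{h\to0}h^{-1}(F(h)-F(0))f_h$ exists (limits as $h\to 0$, $h>0$); $F'_{mef}(0)f$ is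 the set of all $g\in\mathbf{X}$ arising as the second limit for some such family. $\mathcal{F}_{\mathbf{X}}$ is the set of $F\in\mathcal{E}_{\mathbf{X}}$ with $\mathcal{D}(F'_{mef}(0))$ dense in $\mathbf{X}$. For $F\in\mathcal{F}_{\mathbf{X}}$ each $F'_{mef}(0)f$ consists of one element, and the effective derivative $F'_{ef}(0):\mathcal{D}(F'_{mef}(0))\to\mathbf{X}$ is the linear map with $F'_{ef}(0)f\in F'_{mef}(0)f$. A linear operator is closable (possesses a closure) if the closure of its graph in $\mathbf{X}\times\mathbf{X}$ is the graph of a linear operator, its closure $\overline{Z}$; under the hypotheses of the claim $Z$ is closable. An $lC_0$-semigroup is a continuous function $T:[0,\infty)\to\mathcal{L}(\mathbf{X})$ with $T(0)=I$, $T(l+m)=T(l)T(m)$ for $l,m\ge0$, and $T\in\mathcal{E}_{\mathbf{X}}$. Its generator is the operator $\psi\mapsto\lim_{h\to0}h^{-1}(T(h)\psi-\psi)$ with domain the set of all $\psi$ for which the limit exists. *)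

(* Defs.v *)
From HB Require Import structures.
From mathcomp Require Import all_boot all_order all_algebra.
From mathcomp Require Import complex.
From mathcomp Require Import all_classical all_reals all_analysis.

Set Implicit Arguments.
Unset Strict Implicit.
Unset Printing Implicit Defensive.

Import Order.TTheory GRing.Theory Num.Theory.
Import numFieldNormedType.Exports.

Local Open Scope classical_set_scope.
Local Open Scope ring_scope.

Variant scalar_kind := real_scalars | complex_scalars.

Definition base_field (R : realType) (k : scalar_kind) : numFieldType :=
  match k with
  | real_scalars => R
  | complex_scalars => R[i]
  end.

Definition to_scalar (R : realType) (k : scalar_kind) : R -> base_field R k :=
  match k with
  | real_scalars => fun r => r
  | complex_scalars => fun r => r%:C%C
  end.

Definition complete_space (T : uniformType) :=
  forall G : set_system T, ProperFilter G -> cauchy G -> exists x : T, G --> x.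

Section LocallyConvex.
Context {R : realType} {k : scalar_kind}.
Local Notation K := (base_field R k).
Local Notation iota := (@to_scalar R k).
Context {X : tvsType K}.

Section Seminorms.
Context {Omega : Type}.
Variable p : Omega -> X -> R.

Definition is_seminorm (q : X -> R) :=
  (forall x y, q (x + y) <= q x + q y) /\
  (forall (a : K) x, iota (q (a *: x)) = `|a| * iota (q x)).

(* The family is required to generate the uniformity, not only the topology:
   the entourages of a [tvsType] need not be translation invariant, and
   completeness refers to them. The topology follows, as neighbourhoods are
   the sections of entourages. *)
Definition generating_seminorms :=
  (forall alpha, is_seminorm (p alpha)) /\
  forall E : set (X * X), entourage E <->
    exists (s : seq Omega) (e : R), 0 < e /\
      [set xy | all (fun alpha => p alpha (xy.1 - xy.2) < e) s] `<=` E.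

Definition seminorm_bounded (B : set X) :=
  forall alpha, exists M : R, forall x, B x -> p alpha x <= M.

Definition bounded_operator (G : X -> X) :=
  forall B, seminorm_bounded B -> seminorm_bounded (G @` B).

Definition equicontinuous_family (G : set (X -> X)) :=
  forall alpha, exists s : seq (Omega * R),
    all (fun c => 0 < c.2) s /\
    forall g x, G g -> p alpha (g x) <= \sum_(c <- s) c.2 * p c.1 x.

Definition power_family (F : R -> X -> X) (s : R) : set (X -> X) :=
  [set G | exists (n m : nat) (d : R),
    [/\ (0 < n)%N, (0 < m)%N, 0 <= d, m%:R * d / n%:R <= s &
        G = iter m (F (d / n%:R))]].

(* Functions on [0, +oo[ are functions on R whose values at negative
   arguments are never used. *)
Definition E_class (F : R -> {linear X -> X}) :=
  [/\ forall s : R, 0 <= s -> bounded_operator (F s),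
      forall x, F 0 x = x &
      forall s : R, 0 <= s -> equicontinuous_family (power_family F s)].

Definition mef_derivative (F : R -> X -> X) (f : X) : set X :=
  [set g | exists fs : R -> X,
    fs h @[h --> 0^'+] --> f /\
    (iota h)^-1 *: (F h (fs h) - F 0 (fs h)) @[h --> 0^'+] --> g].

Definition mef_domain (F : R -> X -> X) : set X :=
  [set f | mef_derivative F f !=set0].

(* For F in [F_class] the set [mef_derivative F f] is a singleton on
   [mef_domain F]; elsewhere the value 0 carries no meaning. *)
Definition ef_derivative (F : R -> X -> X) (f : X) : X :=
  xget 0 (mef_derivative F f).

Definition F_class (F : R -> {linear X -> X}) :=
  E_class F /\ dense (mef_domain F).

(* {ptws X -> X} carries the topology of pointwise convergence. *)
Definition lC0_semigroup (T : R -> {linear X -> X}) :=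
  [/\ {within [set s : R | 0 <= s],
         continuous ((fun s => (T s : X -> X)) : R -> {ptws X -> X})},
      forall x, T 0 x = x,
      forall l m : R, 0 <= l -> 0 <= m -> forall x, T (l + m) x = T l (T m x) &
      E_class T].

End Seminorms.

Definition linear_subspace (A : set X) :=
  A 0 /\ forall (a : K) x y, A x -> A y -> A (a *: x + y).

(* The values of [app] outside [dom] carry no meaning. *)
Record linop := Linop {
  dom : set X ;
  app :> X -> X ;
  dom_subspace : linear_subspace dom ;
  app_linear : forall (a : K) x y, dom x -> dom y ->
    app (a *: x + y) = a *: app x + app y }.

Definition graph (Z : linop) : set (X * X) :=
  [set xy | dom Z xy.1 /\ xy.2 = Z xy.1].

Definition closable (Z : linop) :=
  exists W : linop, graph W = closure (graph Z).

(* Meaningful for closable Z only; the default value is Z. *)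
Definition closure_op (Z : linop) : linop :=
  if pselect (closable Z) is left cZ then projT1 (cid cZ) else Z.

Definition is_generator (T : R -> X -> X) (W : linop) :=
  graph W = [set xg |
    (iota h)^-1 *: (T h xg.1 - xg.1) @[h --> 0^'+] --> xg.2].

Record topological_dual := TopologicalDual {
  functional :> {linear X -> K^o} ;
  functional_continuous : continuous functional }.

Definition weak_space := sup_topology (fun phi : topological_dual =>
  Topological.class (initial_topology (functional phi : X -> K^o))).

HB.instance Definition _ := Topological.on weak_space.

Definition weak_cvg (u : nat -> X) (x : X) := u @ \oo --> (x : weak_space).

Definition subsequence (u v : nat -> X) :=
  exists2 phi : nat -> nat, {homo phi : i j / (i < j)%N} & v = u \o phi.

End LocallyConvex.

Arguments linop {R k} X.

(* Main.v *)
(* For [(f, g)] in the closure of the graph of the effective derivative,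
   telescoping gives [F h ^ m f - f = h sum_(j < m) F h ^ j g + o(1)] as
   [h -> 0], uniformly for bounded [m h]. Hence that closure is single-valued,
   and a continuous curve [u] whose right derivative at every [s] is
   [Zbar (u s)] satisfies [F h ^ m (u 0) -> u s] as [h -> 0], [m h -> s]. If
   [Zbar] generates [T], this applies to [u s = T s f], and the constant
   sequences [T (t s) f] satisfy (a)-(c). Conversely, (b) and a diagonal
   argument give step sizes along which the orbit of [f] in [A] converges at all
   times; by (a), (c) and the Hahn-Banach theorem the limit [u s] lies in the
   domain of [Zbar], so that [u] is such a curve and the limit exists along all
   step sizes. These limits extend to a semigroup, whose generator is [Zbar]
   since the domain of [Zbar] contains the orbits of the dense subspace [A]. *)

Require Import Defs.
From HB Require Import structures.
From mathcomp Require Import all_boot all_order all_algebra.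
From mathcomp Require Import complex ring lra.
From mathcomp Require Import all_classical all_reals all_analysis.

Set Implicit Arguments.
Unset Strict Implicit.
Unset Printing Implicit Defensive.

Import Order.TTheory GRing.Theory Num.Theory.
Import numFieldNormedType.Exports.

Local Open Scope classical_set_scope.
Local Open Scope ring_scope.

(** * Continuous seminorms *)

(** The obstacle is that equicontinuity bounds [q (iter m (F h) x)] by [q' x] with a seminorm [q']
    that may be larger than [q], so that applying the bound once per time step would change the
    seminorm each time. The estimates are therefore arranged so that the number of passages from [q]
    to a larger seminorm does not depend on the number of time steps. Moreover, only powers of one
    and the same [F h] are controlled, and powers for two different step sizes cannot be compared
    directly. Limits are thus taken along a set of step sizes, and the passage from a sequence of
    step sizes to all of them comes from the trajectory argument. Generation is obtained without
    resolvents or vector-valued integrals: finite sums of orbits of [A] stay in the domain by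
    linearity, and closedness of the graph absorbs the limit. *)

Section Scalars.
Variables (R : realType) (k : scalar_kind).
Local Notation K := (base_field R k).
Local Notation iota := (@to_scalar R k).

Lemma to_scalar_zmod_morphism : zmod_morphism iota.
Proof. by rewrite /zmod_morphism; case: k => x y //=; rewrite raddfB. Qed.

Lemma to_scalar_monoid_morphism : monoid_morphism iota.
Proof.
split; first by case: k.
by case: k => x y //=; rewrite rmorphM.
Qed.

HB.instance Definition _ :=
  GRing.isZmodMorphism.Build R K iota to_scalar_zmod_morphism.
HB.instance Definition _ :=
  GRing.isMonoidMorphism.Build R K iota to_scalar_monoid_morphism.

Lemma ler_to_scalar (a b : R) : (iota a <= iota b) = (a <= b).
Proof. by case: k => //=; rewrite lecR. Qed.

Lemma ltr_to_scalar (a b : R) : (iota a < iota b) = (a < b).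
Proof. by case: k => //=; rewrite ltcR. Qed.

Lemma to_scalar_inj : injective iota.
Proof.
by move=> a b ab; apply: le_anti; rewrite -!ler_to_scalar ab lexx.
Qed.

Lemma norm_to_scalar (r : R) : `|iota r| = iota `|r|.
Proof.
have [r0|r0] := leP 0 r.
  by rewrite !ger0_norm// -(rmorph0 iota) ler_to_scalar.
by rewrite !ltr0_norm ?rmorphN// -(rmorph0 iota) ltr_to_scalar.
Qed.

Lemma to_scalarV (r : R) : (iota r)^-1 = iota r^-1.
Proof. by rewrite fmorphV. Qed.

Lemma norm_is_real (a : K) : exists c : R, `|a| = iota c.
Proof.
case: k a => /= a; first by exists `|a|.
by case: a => x y; exists (Num.sqrt (x ^+ 2 + y ^+ 2)); rewrite normc_def.
Qed.

End Scalars.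

Section Seminorm.
Context {R : realType} {k : scalar_kind} {X : tvsType (base_field R k)}.
Local Notation iota := (@to_scalar R k).
Variables (q : X -> R) (q_seminorm : is_seminorm q).

Lemma seminormD x y : q (x + y) <= q x + q y.
Proof. by have [+ _] := q_seminorm; apply. Qed.

Lemma seminormZ (r : R) x : q (iota r *: x) = `|r| * q x.
Proof.
have [_ qZ] := q_seminorm; apply: (@to_scalar_inj R k).
by rewrite qZ rmorphM/= norm_to_scalar.
Qed.

Lemma seminorm0 : q 0 = 0.
Proof. by have := seminormZ 0 0; rewrite rmorph0 scale0r normr0 mul0r. Qed.

Lemma seminormN x : q (- x) = q x.
Proof. by have := seminormZ (-1) x; rewrite rmorphN1 scaleN1r normrN1 mul1r. Qed.

Lemma seminormBC x y : q (x - y) = q (y - x).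
Proof. by rewrite -seminormN opprB. Qed.

Lemma seminorm_ge0 x : 0 <= q x.
Proof.
have := seminormD x (- x); rewrite subrr seminorm0 seminormN => ?; lra.
Qed.

Lemma seminormB x y : q (x - y) <= q x + q y.
Proof. by rewrite -(seminormN y); exact: seminormD. Qed.

Lemma seminormBD x y z : q (x - z) <= q (x - y) + q (y - z).
Proof. by rewrite -(subrKA y); exact: seminormD. Qed.

Lemma seminorm_sum (I : Type) (s : seq I) (f : I -> X) :
  q (\sum_(i <- s) f i) <= \sum_(i <- s) q (f i).
Proof.
elim/big_ind2 : _ => [|x1 x2 y1 y2 h1 h2|//]; first by rewrite seminorm0.
by apply: le_trans (seminormD _ _) _; exact: lerD.
Qed.

End Seminorm.

Section ContinuousSeminorms.
Context {R : realType} {k : scalar_kind} {X : tvsType (base_field R k)}.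
Local Notation iota := (@to_scalar R k).
Context {Omega : Type}.
Variables (p : Omega -> X -> R).

(** Domination by finitely many generating seminorms amounts to continuity. Unlike the family [p],
    this class is closed under sums, so a single seminorm and a single radius describe a
    neighbourhood, an entourage or an equicontinuity bound. *)
Definition continuous_seminorm (q : X -> R) := is_seminorm q /\
  exists (s : seq Omega) (M : R), 0 <= M /\
    forall x, q x <= M * \sum_(alpha <- s) p alpha x.

Hypothesis p_generates : generating_seminorms p.
Local Notation csn := continuous_seminorm.

Let p_seminorm alpha : is_seminorm (p alpha).
Proof. by have [+ _] := p_generates; apply. Qed.

Lemma csn_seminorm q : csn q -> is_seminorm q. Proof. by case. Qed.
Local Hint Resolve csn_seminorm : core.

Lemma csn_generating alpha : csn (p alpha).
Proof.
split=> //; exists [:: alpha], 1; split=> // x.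
by rewrite big_seq1 mul1r.
Qed.

Lemma csn_zero : csn (fun _ => 0).
Proof.
split; first by split=> [x y|a x]; rewrite ?addr0// rmorph0 mulr0.
by exists [::], 0; split=> // x; rewrite mul0r.
Qed.

Lemma csnD q1 q2 : csn q1 -> csn q2 -> csn (fun x => q1 x + q2 x).
Proof.
move=> [q1s [s1 [M1 [M10 le1]]]] [q2s [s2 [M2 [M20 le2]]]]; split.
  split=> [x y|a x]; last first.
    by case: q1s q2s => [_ q1Z] [_ q2Z]; rewrite rmorphD/= q1Z q2Z -mulrDr -rmorphD.
  have := seminormD q1s x y; have := seminormD q2s x y; lra.
exists (s1 ++ s2), (M1 + M2); split; first exact: addr_ge0.
move=> x; rewrite big_cat/= mulrDl !mulrDr.
have p0 s : 0 <= \sum_(alpha <- s) p alpha x.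
  by apply: sumr_ge0 => i _; exact: seminorm_ge0.
have := le1 x; have := le2 x.
have := mulr_ge0 M10 (p0 s2); have := mulr_ge0 M20 (p0 s1); lra.
Qed.

Lemma csnZ c q : 0 <= c -> csn q -> csn (fun x => c * q x).
Proof.
move=> c0 [qs [s [M [M0 le]]]]; split.
  split=> [x y|a x]; last first.
    by case: qs => [_ qZ]; rewrite rmorphM/= qZ mulrCA -rmorphM.
  by rewrite -mulrDr ler_wpM2l// seminormD.
exists s, (c * M); split; first exact: mulr_ge0.
by move=> x; rewrite -mulrA ler_wpM2l.
Qed.

Lemma csn_sum (s : seq Omega) : csn (fun x => \sum_(alpha <- s) p alpha x).
Proof.
elim: s => [|a s ih].
  by under eq_fun do rewrite big_nil; exact: csn_zero.
under eq_fun do rewrite big_cons.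
by apply: csnD => //; exact: csn_generating.
Qed.

Lemma equicontinuous_csn (G : set (X -> X)) q :
  equicontinuous_family p G -> csn q ->
  exists2 q', csn q' & forall g x, G g -> q (g x) <= q' x.
Proof.
move=> eqG [qs [s [M [M0 le]]]].
have [q' q's leq'] : exists2 q', csn q' &
    forall g x, G g -> \sum_(alpha <- s) p alpha (g x) <= q' x.
  elim: s {le} => [|a s [q' q's leq']].
    exists (fun _ => 0); first exact: csn_zero.
    by move=> g x _; rewrite big_nil.
  have [c [c0 lec]] := eqG a.
  have [q'' q''s leq''] : exists2 q'', csn q'' &
      forall x, \sum_(d <- c) d.2 * p d.1 x <= q'' x.
    elim: c c0 {lec} => [|d c ih].
      exists (fun _ => 0); first exact: csn_zero.
      by move=> x; rewrite big_nil.
    move=> /= /andP[d0 /ih[r rs ler]].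
    exists (fun x => d.2 * p d.1 x + r x).
      by apply: csnD => //; apply: csnZ (ltW d0) _; exact: csn_generating.
    by move=> x; rewrite big_cons lerD2l.
  exists (fun x => q'' x + q' x); first exact: csnD.
  move=> g x Gg; rewrite big_cons lerD ?leq'//.
  by apply: le_trans (lec _ _ Gg) _; exact: leq''.
exists (fun x => M * q' x); first exact: csnZ.
by move=> g x Gg; apply: le_trans (le _) _; rewrite ler_wpM2l// leq'.
Qed.

Lemma entourage_csnP (E : set (X * X)) :
  entourage E <-> exists q e, [/\ csn q, 0 < e &
    forall x y, q (x - y) < e -> E (x, y)].
Proof.
have [_ entE] := p_generates; rewrite entE; split.
  move=> [s [e [e0 sE]]].
  exists (fun x => \sum_(alpha <- s) p alpha x), e; split => //.
    exact: csn_sum.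
  move=> x y lt_e; apply: sE => /=; elim: s lt_e => //= a s ih.
  rewrite big_cons => lt_e.
  have := seminorm_ge0 (p_seminorm a) (x - y).
  have := seminorm_ge0 (csn_seminorm (csn_sum s)) (x - y).
  by move=> *; apply/andP; split; [lra|apply: ih; lra].
move=> [q [e [[qs [s [M [M0 le]]]] e0 qE]]].
(* The summand 1 keeps the divisor positive when [M] or [size s] vanishes, and makes the final
   inequality strict. *)
have N0 : 0 < M * (size s)%:R + 1 :> R by rewrite ltr_wpDl// mulr_ge0.
exists s, (e / (M * (size s)%:R + 1)); split; first exact: divr_gt0.
move=> [x y] /= lt_e; apply: qE; apply: le_lt_trans (le _) _.
set e' := e / _ in lt_e.
have e'0 : 0 < e' by exact: divr_gt0.
have sum_le (s' : seq Omega) d : all (fun alpha => p alpha (x - y) < d) s' ->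
    \sum_(alpha <- s') p alpha (x - y) <= (size s')%:R * d.
  elim: s' => [|a s' ih] /=; first by rewrite big_nil mul0r.
  move=> /andP[/ltW ad /ih {}ih]; rewrite big_cons -natr1 mulrDl mul1r addrC.
  exact: lerD.
have /(ler_wpM2l M0) /le_lt_trans := sum_le _ _ lt_e; apply; rewrite mulrA.
have -> : e = (M * (size s)%:R + 1) * e' by rewrite /e' mulrC divfK// gt_eqF.
by rewrite mulrDl mul1r ltrDl.
Qed.

Lemma nbhs_csnP (x : X) (A : set X) :
  nbhs x A <-> exists q e, [/\ csn q, 0 < e & forall y, q (y - x) < e -> A y].
Proof.
rewrite -filter_from_entourageE; split.
  move=> [E /entourage_csnP[q [e [qs e0 qE]]] EA].
  exists q, e; split => // y lt_e; apply/EA/xsectionP/qE.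
  by rewrite seminormBC; auto.
move=> [q [e [qs e0 qA]]].
exists [set xy | q (xy.1 - xy.2) < e].
  by apply/entourage_csnP; exists q, e; split.
by move=> y /xsectionP /= lt_e; apply: qA; rewrite seminormBC; auto.
Qed.

Lemma nbhs_csn q e (x : X) : csn q -> 0 < e -> nbhs x [set y | q (y - x) < e].
Proof. by move=> qs e0; apply/nbhs_csnP; exists q, e; split. Qed.

Lemma cvg_csnP (T : Type) (G : set_system T) {FG : Filter G} (f : T -> X) (l : X) :
  f @ G --> l <->
  forall q e, csn q -> 0 < e -> \forall t \near G, q (f t - l) < e.
Proof.
split=> [fl q e qs e0|fl A /nbhs_csnP[q [e [qs e0 qA]]]].
  exact: fl (nbhs_csn l qs e0).
by rewrite /= nbhs_simpl /=; apply: filterS (fl q e qs e0) => t; exact: qA.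
Qed.

Lemma dense_csn (A : set X) (x : X) q (e : R) : dense A -> csn q -> 0 < e ->
  exists2 y, A y & q (y - x) < e.
Proof.
move=> dA qs e0.
have /nbhs_interior := nbhs_csn x qs e0 => xi.
have [y [/interior_subset yx Ay]] : ([set y | q (y - x) < e]^° `&` A) !=set0.
  apply: dA; last exact: open_interior.
  by exists x; apply: nbhs_singleton.
by exists y.
Qed.

Lemma closure_prod_csnP (A : set (X * X)) (x y : X) :
  closure A (x, y) <->
  forall q e, csn q -> 0 < e ->
    exists x' y', [/\ A (x', y'), q (x' - x) < e & q (y' - y) < e].
Proof.
split=> [clA q e qs e0|clA B [[B1 B2]] /= [/nbhs_csnP[q1 [e1 [q1s e10 le1]]]
    /nbhs_csnP[q2 [e2 [q2s e20 le2]]] BB]].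
  have [|[x' y'] [/= Axy [? ?]]] :=
      clA [set xy | q (xy.1 - x) < e /\ q (xy.2 - y) < e].
    exists ([set x' | q (x' - x) < e], [set y' | q (y' - y) < e]) => //=.
    by split; exact: nbhs_csn.
  by exists x', y'.
have [|x' [y' [Axy lx ly]]] :=
    clA (fun x => q1 x + q2 x) (Num.min e1 e2) (csnD q1s q2s).
  by rewrite lt_min e10.
exists (x', y'); split => //; apply: BB; split => /=.
  apply: le1; move: lx; rewrite lt_min => /andP[+ _]; apply: le_lt_trans.
  by rewrite lerDl; apply: seminorm_ge0; auto.
apply: le2; move: ly; rewrite lt_min => /andP[_]; apply: le_lt_trans.
by rewrite lerDr; apply: seminorm_ge0; auto.
Qed.

Lemma csn_eq0 (x : X) : hausdorff_space X ->
  (forall q, csn q -> q x = 0) -> x = 0.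
Proof.
move=> hX x0; apply/esym/hX => A B /nbhs_csnP[q1 [e1 [q1s e10 le1]]].
move=> /nbhs_singleton Bx; exists x; split => //; apply: le1.
by rewrite subr0 x0.
Qed.

Lemma hausdorff_csn (x y : X) : hausdorff_space X ->
  (forall q e, csn q -> 0 < e -> q (x - y) <= e) -> x = y.
Proof.
move=> hX xy; apply/eqP; rewrite -subr_eq0; apply/eqP/csn_eq0 => // q qs.
apply/eqP; rewrite eq_le seminorm_ge0 ?andbT; auto.
by apply/ler_addgt0Pr => e e0; rewrite add0r; exact: xy.
Qed.

End ContinuousSeminorms.

(** * Orbits of [F] and the effective derivative *)

Section RealPreliminaries.
Context {R : realType}.

Lemma near_right0P (P : R -> Prop) :
  (\forall h \near 0^'+, P h) <->
  exists2 eta, 0 < eta & forall h, 0 < h < eta -> P h.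
Proof.
rewrite near_withinE; split=> [/nbhs_ballP[e /= e0 eP]|[e e0 eP]].
  exists e => // h /andP[h0 he]; apply: eP => //=.
  by rewrite /ball/= sub0r normrN gtr0_norm.
apply/nbhs_ballP; exists e => //= h; rewrite /ball/= sub0r normrN => he h0.
by apply: eP; rewrite h0; move: he; rewrite gtr0_norm.
Qed.

Lemma truncn_step (h s : R) : 0 < h -> 0 <= s ->
  (Num.truncn (s / h))%:R * h <= s /\ s < (Num.truncn (s / h))%:R * h + h.
Proof.
move=> h0 s0; have /andP[] := truncn_itv (divr_ge0 s0 (ltW h0)).
by rewrite ler_pdivlMr// ltr_pdivrMr// -natr1 mulrDl mul1r.
Qed.

(** The set [A] of good points need not be an interval, since [Pleft] only asks for good points
    arbitrarily close on the left. Its supremum is good by [Pleft], and [Pright] forbids it to be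
    smaller than [s]. *)
Lemma real_induction (P : R -> Prop) (s : R) : 0 <= s -> P 0 ->
  (forall r, 0 <= r < s -> P r ->
    exists2 d, 0 < d & forall r', r < r' < r + d -> r' <= s -> P r') ->
  (forall r, 0 < r <= s ->
    (forall d, 0 < d -> exists r', [/\ 0 <= r', r - d < r', r' < r & P r']) ->
    P r) ->
  P s.
Proof.
move=> s0 P0 Pright Pleft.
pose A := [set r | 0 <= r <= s /\ P r].
have A0 : A 0 by rewrite /A/= lexx s0.
have supA : has_sup A.
  by split; [exists 0|exists s => r [/andP[]]].
have sA0 : 0 <= sup A by exact: sup_upper_bound.
have sAs : sup A <= s by apply: ge_sup => [|r [/andP[]]//]; exists 0.
have PsA : P (sup A).
  have [-> //|sup0] := eqVneq (sup A) 0.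
  have [//|nP] := pselect (P (sup A)).
  apply: Pleft => [|d d0]; first by rewrite sAs lt_neqAle eq_sym sup0 sA0.
  have [r Ar ltr] := sup_adherent d0 supA.
  have := sup_upper_bound supA Ar; rewrite le_eqVlt => /orP[/eqP rA|rA].
    by case: nP; rewrite -rA; case: Ar.
  by case: Ar => /andP[r0 rs] Pr; exists r; split.
have := sAs; rewrite le_eqVlt => /orP[/eqP <- //|sAs'].
have [|d d0 dP] := Pright _ _ PsA; first by rewrite sA0.
pose r' := Num.min s (sup A + d / 2).
have r's : r' <= s by rewrite ge_min lexx.
have r'A : sup A < r' by rewrite lt_min sAs'/=; lra.
have r'd : r' <= sup A + d / 2 by rewrite ge_min lexx orbT.
have Ar' : A r'.
  split; first by rewrite r's andbT; lra.
  by apply: dP => //; rewrite r'A/=; lra.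
have := sup_upper_bound supA Ar'; lra.
Qed.

End RealPreliminaries.

Section IterLinear.
Context {K : pzRingType} {V : lmodType K}.

Lemma iter_linear (G : {linear V -> V}) m : linear (iter m G).
Proof. by elim: m => [|m ih] a x y //=; rewrite ih linearP. Qed.

HB.instance Definition _ (G : {linear V -> V}) m :=
  GRing.isLinear.Build K V V _ (iter m G) (iter_linear G m).

Lemma iter_subr (G : {linear V -> V}) m x :
  iter m G x - x = \sum_(j < m) iter j G (G x - x).
Proof.
elim: m => [|m ih]; first by rewrite big_ord0 subrr.
by rewrite big_ord_recr/= -ih linearB/= -iterSr/= [RHS]addrC addrA subrK.
Qed.

End IterLinear.

Section Orbits.
Context {R : realType} {k : scalar_kind} {X : tvsType (base_field R k)}.
Local Notation iota := (@to_scalar R k).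
Context {Omega : Type} {p : Omega -> X -> R} {F : R -> {linear X -> X}}.
Hypothesis p_generates : generating_seminorms p.
Hypothesis FE : E_class p F.
Local Notation csn := (continuous_seminorm p).
Local Notation sn := csn_seminorm.

Let F0 x : F 0 x = x. Proof. by case: FE. Qed.

Lemma power_csn (s : R) q : csn q -> exists q', [/\ csn q',
  forall x, q x <= q' x &
  forall (h : R) m x, 0 < h -> m%:R * h <= s -> q (iter m (F h) x) <= q' x].
Proof.
move=> qs; have [_ _ /(_ (Num.max 0 s))] := FE.
rewrite le_max lexx => /(_ isT) /(equicontinuous_csn p_generates) /(_ qs).
move=> [q' q's le].
(* [q'] serves the positive exponents; adding [q] covers the exponent 0, which [power_family]
   excludes, and makes the majorant dominate [q]. *)
exists (fun x => q x + q' x); split; first exact: csnD.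
  by move=> x; rewrite lerDl (seminorm_ge0 (sn q's)).
move=> h [|m] x h0 ms; first by rewrite /= lerDl (seminorm_ge0 (sn q's)).
apply: (@le_trans _ _ (q' x)); last by rewrite lerDr (seminorm_ge0 (sn qs)).
apply: le; exists 1%N, m.+1, h; split => //; first exact: ltW.
  by rewrite divr1 le_max ms orbT.
by rewrite divr1.
Qed.

(** The closure is that of the many-valued relation, because single-valuedness is itself derived
    from estimates on this closure, in [mef_closure0]. *)
Definition mef_closure : set (X * X) :=
  closure [set fg | mef_derivative F fg.1 fg.2].

(** Telescoping is exact for the approximant [v = fs h], whose difference quotient [w] is close to
    [g]. Replacing [v] by [f] and [w] by [g] costs only equicontinuity bounds, uniform for
    [m * h <= s]. *)
Lemma mef_closure_increment (f g : X) (s : R) q (e : R) :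
  mef_closure (f, g) -> 0 <= s -> csn q -> 0 < e ->
  exists2 eta, 0 < eta & forall (h : R) m, 0 < h < eta -> m%:R * h <= s ->
    q (iter m (F h) f - f - iota h *: \sum_(j < m) iter j (F h) g) <= e.
Proof.
move=> fg s0 qs e0; have [q' [q's qq' leq']] := power_csn s qs.
have q'0 := seminorm_ge0 (sn q's).
(* [f - v] and [w - g] are both bounded by [2 * d]: the first enters twice, giving [4 * d], and the
   second enters through [h] times a sum of [m] terms, giving [2 * s * d]. *)
pose d := e / (4 + 2 * s).
have d0 : 0 < d by rewrite divr_gt0//; lra.
have [f1 [g1 [/= [fs [fsf fsg]] f1f g1g]]] :=
  (closure_prod_csnP p_generates _ _ _).1 fg q' d q's d0.
have [eta1 eta10 le1] := (near_right0P _).1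
  ((cvg_csnP p_generates _ _).1 fsf q' d q's d0).
have [eta2 eta20 le2] := (near_right0P _).1
  ((cvg_csnP p_generates _ _).1 fsg q' d q's d0).
exists (Num.min eta1 eta2); first by rewrite lt_min eta10.
move=> h m /andP[h0]; rewrite lt_min => /andP[h1 h2] mhs.
have {le1} := le1 h; rewrite h0 h1 => /(_ isT) le1.
have {le2} := le2 h; rewrite h0 h2 => /(_ isT) /=; rewrite F0 to_scalarV => le2.
set v := fs h in le1 le2.
set w := iota h^-1 *: (F h v - v) in le2.
have fv : q' (f - v) <= 2 * d.
  apply: le_trans (seminormBD (sn q's) _ f1 _) _.
  by rewrite (seminormBC (sn q's) f) (seminormBC (sn q's) _ v); lra.
have gw : q' (w - g) <= 2 * d.
  by apply: le_trans (seminormBD (sn q's) _ g1 _) _; lra.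
have -> : iter m (F h) f - f - iota h *: \sum_(j < m) iter j (F h) g =
    iter m (F h) (f - v) - (f - v) + iota h *: \sum_(j < m) iter j (F h) (w - g).
  have -> : \sum_(j < m) iter j (F h) (w - g) =
      iota h^-1 *: (iter m (F h) v - v) - \sum_(j < m) iter j (F h) g.
    rewrite iter_subr scaler_sumr -sumrB; apply: eq_bigr => j _.
    by rewrite linearB linearZ.
  rewrite scalerBr scalerA -rmorphM/= divff ?gt_eqF// rmorph1 scale1r linearB/=.
  by rewrite addrA addrACA subrK -opprD subrK.
apply: le_trans (seminormD (sn qs) _ _) _.
have h1' := seminormB (sn qs) (iter m (F h) (f - v)) (f - v).
have h2' := leq' h m (f - v) h0 mhs.
have h3' := qq' (f - v).
have h4' : q (iota h *: \sum_(j < m) iter j (F h) (w - g)) <= s * (2 * d).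
  rewrite (seminormZ (sn qs)) gtr0_norm//.
  apply: (@le_trans _ _ (h * \sum_(j < m) (2 * d))).
    rewrite ler_wpM2l ?(ltW h0)//; apply: le_trans (seminorm_sum (sn qs) _ _) _.
    apply: ler_sum => j _; apply: le_trans gw; apply: leq' => //.
    apply: le_trans mhs; by rewrite ler_wpM2r ?(ltW h0)// ler_nat ltnW.
  rewrite sumr_const card_ord -[X in h * X]mulr_natl mulrA (mulrC h).
  by apply: ler_wpM2r => //; lra.
have : e = (4 + 2 * s) * d by rewrite /d mulrC divfK// gt_eqF//; lra.
by rewrite mulrDl => ->; lra.
Qed.

Hypothesis F_dense : dense (mef_domain F).

(** For [f] in the dense domain an orbit moves by at most about [m * h * q' g]. Equicontinuity
    carries this from a nearby [f] to an arbitrary [x], each of the four errors being at most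
    [e / 4]. *)
Lemma orbit_continuous0 (x : X) q (e : R) : csn q -> 0 < e ->
  exists2 delta, 0 < delta & forall (h : R) m, 0 < h < delta -> m%:R * h <= delta ->
    q (iter m (F h) x - x) <= e.
Proof.
move=> qs e0; have [q' [q's qq' leq']] := power_csn 1 qs.
have q'0 := seminorm_ge0 (sn q's).
have e4 : 0 < e / 4 by lra.
have [f [g fg] fx] := dense_csn p_generates x F_dense q's e4.
have fg' : mef_closure (f, g) by exact: subset_closure.
have [eta eta0 le] := mef_closure_increment fg' ler01 qs e4.
have B0 : 0 < q' g + 1 by apply: ltr_wpDl.
pose d := e / 4 / (q' g + 1).
have d0 : 0 < d by rewrite divr_gt0.
exists (Num.min 1 (Num.min eta d)); first by rewrite !lt_min ltr01 eta0.
move=> h m /andP[h0]; rewrite !lt_min !le_min => /and3P[h1 heta hd] /and3P[m1 meta md].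
have {le} := le h m; rewrite h0 heta => /(_ isT m1) le.
set S := iota h *: _ in le.
have qS : q S <= e / 4.
  rewrite /S (seminormZ (sn qs)) gtr0_norm//.
  apply: (@le_trans _ _ (m%:R * h * q' g)); last first.
    apply: (@le_trans _ _ (d * (q' g + 1))); last by rewrite divfK// gt_eqF.
    by apply: ler_pM => //; [rewrite mulr_ge0// ltW|lra].
  rewrite mulrAC [leRHS]mulrC ler_wpM2l ?(ltW h0)//.
  apply: le_trans (seminorm_sum (sn qs) _ _) _.
  rewrite mulr_natl -[X in _ *+ X](card_ord m) -sumr_const.
  apply: ler_sum => j _; apply: leq' => //; apply: le_trans m1.
  by rewrite ler_wpM2r ?(ltW h0)// ler_nat ltnW.
have t1 := seminormBD (sn qs) (iter m (F h) x) (iter m (F h) f) x.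
have t2 := seminormBD (sn qs) (iter m (F h) f) f x.
have t6 := seminormD (sn qs) (iter m (F h) f - f - S) S; rewrite subrK in t6.
rewrite -linearB/= in t1.
have t3 := leq' h m (x - f) h0 m1.
have t4 := qq' (f - x).
have t5 := seminormBC (sn q's) x f.
lra.
Qed.

(** Since the orbit of [g] is continuous at time 0, the sum of the increment formula can be replaced
    by [m] copies of [g]. The error is relative to the horizon [d], not to [m * h], and [eta]
    depends on [d] while [delta] does not. *)
Lemma orbit_derivative (f g : X) q (e : R) : mef_closure (f, g) -> csn q -> 0 < e ->
  exists2 delta, 0 < delta & forall d, 0 < d <= delta ->
  exists2 eta, 0 < eta & forall (h : R) m, 0 < h < eta -> m%:R * h <= d ->
    q (iter m (F h) f - f - iota (m%:R * h) *: g) <= e * d.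
Proof.
move=> fg qs e0; have e2 : 0 < e / 2 by lra.
have [delta delta0 le1] := orbit_continuous0 g qs e2.
exists delta => // d /andP[d0 dd].
have ed : 0 < e / 2 * d by rewrite mulr_gt0.
have [eta eta0 le2] := mef_closure_increment fg (ltW d0) qs ed.
exists (Num.min eta delta); first by rewrite lt_min eta0.
move=> h m; rewrite lt_min => /and3P[h0 h1 h2] md.
have {le2} := le2 h m; rewrite h0 h1 => /(_ isT md) le2.
set S := iota h *: _ in le2.
have qS : q (S - iota (m%:R * h) *: g) <= e / 2 * d.
  have -> : S - iota (m%:R * h) *: g = iota h *: \sum_(j < m) (iter j (F h) g - g).
    rewrite sumrB scalerBr sumr_const card_ord -[in RHS]scaler_nat scalerA.
    by rewrite (mulrC m%:R) rmorphM rmorph_nat.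
  rewrite (seminormZ (sn qs)) gtr0_norm//.
  apply: (@le_trans _ _ (m%:R * h * (e / 2))); last first.
    by rewrite mulrC ler_wpM2l// ltW.
  rewrite mulrAC [leRHS]mulrC ler_wpM2l ?(ltW h0)//.
  apply: le_trans (seminorm_sum (sn qs) _ _) _.
  rewrite mulr_natl -[X in _ *+ X](card_ord m) -sumr_const.
  apply: ler_sum => j _; apply: le1; first by rewrite h0.
  apply: le_trans dd; apply: le_trans md.
  by rewrite ler_wpM2r ?(ltW h0)// ler_nat ltnW.
rewrite -(subrKA S); apply: le_trans (seminormD (sn qs) _ _) _; lra.
Qed.

(** The orbit of 0 does not move, so the derivative estimate reads [m * h * q g <= e / 2 * d]; an
    exponent with [m * h >= d / 2] gives [q g <= e]. *)
Lemma mef_closure0 (g : X) : hausdorff_space X -> mef_closure (0, g) -> g = 0.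
Proof.
move=> hX fg; apply: (hausdorff_csn p_generates) => // q e qs e0.
rewrite subr0; have e2 : 0 < e / 2 by lra.
have [d d0 dP] := orbit_derivative fg qs e2.
have [|eta eta0 le] := dP d; first by rewrite d0/=.
pose h := Num.min (eta / 2) (d / 2).
have h0 : 0 < h by rewrite lt_min; apply/andP; split; lra.
have heta : h <= eta / 2 by rewrite ge_min lexx.
have hd : h <= d / 2 by rewrite ge_min lexx orbT.
have [m1 m2] := truncn_step h0 (ltW d0).
set m := Num.truncn _ in m1 m2.
have := le h m; rewrite h0 => /(_ ltac:(lra) m1).
rewrite linear0 subrr sub0r (seminormN (sn qs)) (seminormZ (sn qs)).
have mh : d / 2 <= m%:R * h by lra.
rewrite ger0_norm; last by apply: mulr_ge0 => //; exact: ltW.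
move=> le3; have := ler_wpM2r (seminorm_ge0 (sn qs) g) mh => le4.
have : d / 2 * q g <= d / 2 * e by lra.
by rewrite ler_pM2l ?divr_gt0.
Qed.

End Orbits.

Arguments mef_closure {R k X} F.

(** * Convergence of orbits to a differentiable trajectory *)

Section Chernoff.
Context {R : realType} {k : scalar_kind} {X : tvsType (base_field R k)}.
Local Notation iota := (@to_scalar R k).
Context {Omega : Type} {p : Omega -> X -> R} {F : R -> {linear X -> X}}.
Hypothesis p_generates : generating_seminorms p.
Hypothesis FE : E_class p F.
Hypothesis F_dense : dense (mef_domain F).
Local Notation csn := (continuous_seminorm p).
Local Notation sn := csn_seminorm.

(** The limit as [h] tends to 0 inside [H] and [m * h] tends to [s]: with [H] the steps of a
    subsequence or [setT], the same lemmas serve partial and full limits. The condition is empty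
    unless [H] accumulates at 0, whence [arbitrarily_small] below. *)
Definition orbit_cvg (H : set R) (f : X) (s : R) (l : X) :=
  forall q (e : R), csn q -> 0 < e ->
  exists2 eta, 0 < eta & forall (h : R) m, H h -> 0 < h < eta ->
    `|m%:R * h - s| < eta -> q (iter m (F h) f - l) <= e.

(** For [n <= m] the difference is the [n]-th power of [F h] applied to the displacement of [x]
    under [m - n] iterations, which continuity at time 0 makes small in the larger seminorm. *)
Lemma orbit_equicontinuous (x : X) (s : R) q (e : R) : csn q -> 0 < e ->
  exists2 delta, 0 < delta & forall (h : R) m n, 0 < h < delta ->
    m%:R * h <= s -> n%:R * h <= s -> `|m%:R * h - n%:R * h| <= delta ->
    q (iter m (F h) x - iter n (F h) x) <= e.
Proof.
move=> qs e0; have [q' [q's _ leq']] := power_csn p_generates FE s qs.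
have [d d0 dP] := orbit_continuous0 p_generates FE F_dense x q's e0.
exists d => // h m n /[dup] hd /andP[h0 _].
wlog nm : m n / (n <= m)%N => [hw ms ns mn|].
  have [/hw|/ltnW/hw] := leqP n m; first exact.
  by rewrite (seminormBC (sn qs)) distrC in mn *; apply.
move=> ms ns; rewrite -(subnK nm) addnC iterD -linearB/= natrD mulrDl addrC addKr.
rewrite ger0_norm => [mn|]; last by rewrite mulr_ge0// ltW.
by apply: le_trans (leq' _ _ _ h0 ns) _; exact: dP.
Qed.

(* Continuous induction on [s]: the bound [eps * s + e1] for the distance
   between [F h ^ m (u 0)] and [u s], where [m h ~ s], is propagated to the
   right by the derivative of [u] and to suprema by its left continuity. The
   extra iterations [n] make it stable under composition. *)
Lemma chernoff_trajectory (u g : R -> X) (sigma : R) :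
  (forall s, 0 <= s -> mef_closure F (u s, g s)) ->
  (forall s q (e : R), 0 <= s -> csn q -> 0 < e ->
    exists2 delta, 0 < delta & forall d, 0 < d < delta ->
      q (u (s + d) - u s - iota d *: g s) <= e * d) ->
  (forall s q (e : R), 0 < s -> csn q -> 0 < e ->
    exists2 delta, 0 < delta & forall r, 0 <= r -> s - delta < r < s ->
      q (u r - u s) <= e) ->
  0 <= sigma -> orbit_cvg setT (u 0) sigma (u sigma).
Proof.
move=> ug u_right u_left sigma0 q e qs e0.
(* The unit margin is needed because [m * h] is only close to [sigma] and may exceed it. *)
have [q' [q's qq' leq']] := power_csn p_generates FE (sigma + 1) qs.
have q'0 := seminorm_ge0 (sn q's).
(* At [s = sigma] the bound becomes [eps * sigma + e / 2], which is at most [e]. *)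
pose eps := e / 2 / (sigma + 1).
have sigma1 : 0 < sigma + 1 by lra.
have eps0 : 0 < eps by rewrite !divr_gt0.
(* Since [n] is free inside [q], the induction hypothesis is reused with [n + m2] iterations and the
   same [q]; only the local error of the current step is measured in [q']. Hence the bound does not
   deteriorate with the number of steps. *)
pose P s := forall e1 : R, 0 < e1 ->
  exists2 eta, 0 < eta & forall (h : R) m n, 0 < h < eta ->
    `|m%:R * h - s| < eta -> n%:R * h + m%:R * h <= sigma + 1 ->
    q (iter n (F h) (iter m (F h) (u 0) - u s)) <= eps * s + e1.
suff /(_ (e / 2)) [|eta eta0 etaP] : P sigma; first by rewrite divr_gt0.
  exists (Num.min eta 1) => [|h m _]; first by rewrite lt_min eta0 ltr01.
  rewrite !lt_min => /and3P[h0 h1 _] /andP[mh mh1].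
  have {etaP} := etaP h m 0%N; rewrite h0 h1 => /(_ isT mh).
  rewrite mul0r add0r => /(_ ltac:(move: mh1; rewrite ltr_distl; lra)) /=.
  have -> : e = e / 2 + e / 2 by lra.
  have : e / 2 = eps * (sigma + 1) by rewrite /eps divfK// gt_eqF.
  lra.
have split_iter (h r : R) m n : 0 < h -> 0 <= r -> r < m%:R * h ->
    n%:R * h + m%:R * h <= sigma + 1 ->
    exists m1 m2, [/\ m = (m2 + m1)%N, m1%:R * h <= r < m1%:R * h + h,
      m2%:R * h = m%:R * h - m1%:R * h &
      (n + m2)%:R * h + m1%:R * h <= sigma + 1].
  move=> h0 r0 rm nm; have [m1r m1h] := truncn_step h0 r0.
  set m1 := Num.truncn _ in m1r m1h.
  have m1m : (m1 <= m)%N.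
    by rewrite -(@ler_nat R) -(ler_pM2r h0) (le_trans m1r)// ltW.
  exists m1, (m - m1)%N; split; first by rewrite subnK.
  - by rewrite m1r.
  - by rewrite natrB// mulrBl.
  - by rewrite natrD natrB// mulrDl mulrBl; lra.
apply: real_induction => //.
- move=> e1 e10; have [d d0 dP] := orbit_continuous0 p_generates FE F_dense (u 0) q's e10.
  exists d => // h m n hd; have [h0 _] := andP hd.
  rewrite subr0 mulr0 add0r => mh nm.
  have mh0 : 0 <= m%:R * h by rewrite mulr_ge0// ltW.
  have nh0 : 0 <= n%:R * h by rewrite mulr_ge0// ltW.
  apply: le_trans (leq' _ _ _ h0 _) _; first by lra.
  by apply: dP => //; rewrite ger0_norm// in mh; exact: ltW.
- move=> r /andP[r0 _] Pr.
  have eps8 : 0 < eps / 8 by rewrite divr_gt0.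
  have eps4 : 0 < eps / 4 by rewrite divr_gt0.
  have [d3 d30 d3P] := orbit_derivative p_generates FE F_dense (ug r r0) q's eps8.
  have [dr dr0 drP] := u_right r q' _ r0 q's eps4.
  exists (Num.min (d3 / 2) dr); first by rewrite lt_min dr0 divr_gt0.
  move=> r' /andP[rr' r'd] _ e1 e10.
  pose d := r' - r.
  have [-> d0] : r' = r + d /\ 0 < d by rewrite /d; split; lra.
  have [dd3 ddr] : d < d3 / 2 /\ d < dr.
    by apply/andP; rewrite -lt_min /d; lra.
  have [eta1 eta10 P1] := Pr _ (divr_gt0 e10 (ltr0n R 2)).
  (* The horizon is [2 * d] because [m2 * h] may slightly exceed [d]. With [eps / 8] this costs
     [eps / 4 * d], as does the right derivative of [u], which keeps the sum below [eps * d]. *)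
  have [|eta2 eta20 P2] := d3P (2 * d); first by apply/andP; split; lra.
  have B0 : 0 < q' (g r) + 1 by apply: ltr_wpDl.
  pose eta3 := e1 / 4 / (q' (g r) + 1).
  have eta30 : 0 < eta3 by rewrite !divr_gt0.
  exists (Num.min (Num.min eta1 eta2) (Num.min eta3 d / 2)).
    by rewrite !lt_min eta10 eta20 divr_gt0// lt_min eta30.
  move=> h m n; rewrite !lt_min ltr_pdivlMr// ltr_pdivlMr// !lt_min.
  move=> /and4P[h0 /andP[h1 h2] h3 h4] /andP[/andP[mh1 mh2] /andP[mh3 mh4]] nm.
  move: mh1 mh2 mh3 mh4; rewrite -!ltr_pdivlMr// !ltr_distl => mh1 mh2 mh3 mh4.
  have [|m1 [m2 [mE m1r m2h nm']]] := split_iter h r m n h0 r0 _ nm.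
    by clear -p_generates FE F_dense mh4 h4 d0; lra.
  have nh0 : 0 <= m%:R * h by rewrite mulr_ge0// ltW.
  have le1 := P1 h m1 (n + m2)%N.
  rewrite h0 h1 in le1; have {le1} := le1 isT.
  rewrite ltr_distl => /(_ ltac:(clear -p_generates FE F_dense m1r h0 h1; lra) nm') le1.
  have le2 := P2 h m2; rewrite h0 h2 in le2.
  have {}le2 := le2 isT ltac:(clear -p_generates FE F_dense m2h m1r h4 mh4; lra).
  have le3 := drP d; rewrite d0 ddr in le3; have {}le3 := le3 isT.
  have le4 : q' (iota (m2%:R * h) *: g r - iota d *: g r) <= e1 / 4.
    rewrite -scalerBl -rmorphB (seminormZ (sn q's)).
    apply: (@le_trans _ _ (eta3 * (q' (g r) + 1))).
      apply: ler_pM => //; last by rewrite lerDl.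
      by rewrite ler_norml; clear -p_generates FE F_dense m2h m1r h3 mh3 h0; lra.
    by rewrite /eta3 divfK// gt_eqF.
  have le5 : q (iter n (F h) (iter m2 (F h) (u r) - u (r + d))) <=
      q' (iter m2 (F h) (u r) - u (r + d)) by
        apply: leq' => //; clear -p_generates FE F_dense nm nh0; lra.
  have le6 := seminormBD (sn q's) (iter m2 (F h) (u r) - u r)
    (iota (m2%:R * h) *: g r) (u (r + d) - u r).
  have le7 := seminormBD (sn q's) (iota (m2%:R * h) *: g r)
    (iota d *: g r) (u (r + d) - u r).
  rewrite [q' (iota d *: _ - _)](seminormBC (sn q's)) in le7.
  rewrite (_ : _ - u r - _ = iter m2 (F h) (u r) - u (r + d)) in le6;
    last by rewrite opprB subrKA.
  have le8 := seminormD (sn qs) (iter (n + m2) (F h) (iter m1 (F h) (u 0) - u r))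
    (iter n (F h) (iter m2 (F h) (u r) - u (r + d))).
  rewrite mE iterD.
  have -> : iter n (F h) (iter m2 (F h) (iter m1 (F h) (u 0)) - u (r + d)) =
      iter (n + m2) (F h) (iter m1 (F h) (u 0) - u r) +
      iter n (F h) (iter m2 (F h) (u r) - u (r + d)).
    by rewrite iterD -linearD/= [iter m2 _ (_ - _)]linearB/= subrKA.
  by have := mulr_gt0 eps0 d0;
    clear -p_generates FE F_dense e10 le1 le2 le3 le4 le5 le6 le7 le8; lra.
- move=> r /andP[r0 rsigma] Pl e1 e10.
  have e4 : 0 < e1 / 4 by rewrite divr_gt0.
  have [dl dl0 dlP] := u_left r q' _ r0 q's e4.
  have [d0 d00 d0P] := orbit_continuous0 p_generates FE F_dense (u r) q's e4.
  have [|r' [r'0 r'd r'r Pr']] := Pl (Num.min dl (d0 / 2)).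
    by rewrite lt_min dl0 divr_gt0.
  have [eta1 eta10 P1] := Pr' _ e4.
  have [r'dl r'd0] : r - r' < dl /\ r - r' < d0 / 2.
    by apply/andP; rewrite -lt_min; lra.
  (* This keeps [m * h] above [r'], so that the iterations can be split at time [r']. *)
  pose eta2 := (r - r') / 2.
  have eta20 : 0 < eta2 by rewrite /eta2; lra.
  exists (Num.min eta1 (Num.min eta2 (d0 / 4))).
    by rewrite !lt_min eta10 eta20 divr_gt0.
  move=> h m n; rewrite !lt_min !ltr_distl.
  move=> /and4P[h0 h1 h2 h3] /and3P[mh1 mh2 mh3] nm; rewrite /eta2 in h2 mh2.
  have [|m1 [m2 [mE m1r m2h nm']]] := split_iter h r' m n h0 r'0 _ nm.
    by clear -p_generates FE F_dense mh2 r'r; lra.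
  have mh0 : 0 <= m%:R * h by rewrite mulr_ge0// ltW.
  have m1h0 : 0 <= m1%:R * h by rewrite mulr_ge0// ltW.
  have le1 := P1 h m1 (n + m2)%N.
  rewrite h0 h1 in le1; have {le1} := le1 isT.
  rewrite ltr_distl => /(_ ltac:(clear -p_generates FE F_dense m1r h0 h1; lra) nm') le1.
  have le2 : q (iter (n + m2) (F h) (u r' - u r)) <= e1 / 4.
    apply: le_trans (leq' _ _ _ h0 _) _.
      by clear -p_generates FE F_dense nm' m1h0; lra.
    by apply: dlP => //; clear -p_generates FE F_dense r'dl r'r; lra.
  have le3 : q (iter n (F h) (iter m2 (F h) (u r) - u r)) <= e1 / 4.
    apply: le_trans (leq' _ _ _ h0 _) _.
      by clear -p_generates FE F_dense nm mh0; lra.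
    by apply: d0P; clear -p_generates FE F_dense h0 h3 m2h m1r r'd0 mh3 d00; lra.
  have le4 : eps * r' <= eps * r by rewrite ler_wpM2l// ltW.
  have le5 := seminormD (sn qs) (iter (n + m2) (F h) (iter m1 (F h) (u 0) - u r'))
    (iter (n + m2) (F h) (u r' - u r)).
  have le6 := seminormD (sn qs) (iter (n + m2) (F h) (iter m1 (F h) (u 0) - u r))
    (iter n (F h) (iter m2 (F h) (u r) - u r)).
  rewrite -linearD/= subrKA in le5.
  rewrite mE iterD.
  have -> : iter n (F h) (iter m2 (F h) (iter m1 (F h) (u 0)) - u r) =
      iter (n + m2) (F h) (iter m1 (F h) (u 0) - u r) +
      iter n (F h) (iter m2 (F h) (u r) - u r).
    by rewrite iterD -linearD/= [iter m2 _ (_ - _)]linearB/= subrKA.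
  by clear -p_generates FE F_dense e10 le1 le2 le3 le4 le5 le6; lra.
Qed.

End Chernoff.

Arguments orbit_cvg {R k X Omega} p F.

(** * Calculus of limits of orbits along a set of step sizes *)

Section OrbitLimits.
Context {R : realType} {k : scalar_kind} {X : tvsType (base_field R k)}.
Local Notation iota := (@to_scalar R k).
Context {Omega : Type} {p : Omega -> X -> R} {F : R -> {linear X -> X}}.
Hypothesis p_generates : generating_seminorms p.
Hypothesis FE : E_class p F.
Hypothesis F_dense : dense (mef_domain F).
Local Notation csn := (continuous_seminorm p).
Local Notation sn := csn_seminorm.
Local Notation orbit_cvg := (@orbit_cvg R k X Omega p F).

Definition arbitrarily_small (H : set R) :=
  forall eta : R, 0 < eta -> exists2 h, H h & 0 < h < eta.

Lemma arbitrarily_smallT : arbitrarily_small setT.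
Proof. by move=> eta eta0; exists (eta / 2) => //; lra. Qed.

Lemma orbit_cvg_sub (H H' : set R) f s l : H' `<=` H ->
  orbit_cvg H f s l -> orbit_cvg H' f s l.
Proof.
move=> HH' fl q e qs e0; have [eta eta0 etaP] := fl q e qs e0.
by exists eta => // h m /HH'; exact: etaP.
Qed.

(** By equicontinuity in time, one exponent per step size is enough. The tolerance [2 * h] leaves
    room for the sum of two integer parts, as in [orbit_cvg_comp]. *)
Lemma orbit_cvg_of (H : set R) f (s : R) l :
  (forall q (e : R), csn q -> 0 < e -> exists2 eta, 0 < eta &
    forall h : R, H h -> 0 < h < eta ->
    exists2 m, `|m%:R * h - s| <= 2 * h & q (iter m (F h) f - l) <= e) ->
  orbit_cvg H f s l.
Proof.
move=> fl q e qs e0; have e2 : 0 < e / 2 by rewrite divr_gt0.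
have [eta eta0 etaP] := fl q _ qs e2.
have [d d0 dP] := orbit_equicontinuous p_generates FE F_dense f (s + 1) qs e2.
exists (Num.min eta (Num.min (d / 4) (1 / 4))).
  by rewrite !lt_min eta0 !divr_gt0.
move=> h n Hh; rewrite !lt_min => /and4P[h0 h1 h2 h3] /and3P[n1 n2 n3].
have [|m ms ml] := etaP h Hh; first by rewrite h0.
move: ms n2 n3; rewrite !ltr_distl !ler_distl => ms n2 n3.
apply: le_trans (seminormBD (sn qs) _ (iter m (F h) f) _) _.
have := dP h n m; rewrite h0 ler_distl/=.
move=> le; have {le} : q (iter n (F h) f - iter m (F h) f) <= e / 2.
  by clear -p_generates FE F_dense le ms n2 n3 h0 h1 h2 h3; apply: le; lra.
clear -p_generates FE F_dense ml; lra.
Qed.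

Lemma orbit_cvg_floor (H : set R) f (s : R) l q (e : R) :
  0 <= s -> orbit_cvg H f s l -> csn q -> 0 < e ->
  exists2 eta, 0 < eta & forall h : R, H h -> 0 < h < eta ->
    q (iter (Num.truncn (s / h)) (F h) f - l) <= e.
Proof.
move=> s0 fl qs e0; have [eta eta0 etaP] := fl q e qs e0.
exists eta => // h Hh /[dup] heta /andP[h0 h1]; apply: etaP => //.
by have [] := truncn_step h0 s0; rewrite ltr_distl; lra.
Qed.

(** [delta] is chosen before the set of step sizes and the two times. Equal times give uniqueness of
    limits, and distinct ones the continuity of limit curves. *)
Lemma orbit_cvg_modulus (S : R) f q (e : R) : csn q -> 0 < e ->
  exists2 delta, 0 < delta & forall H r r' l l', arbitrarily_small H ->
    0 <= r <= S -> 0 <= r' <= S -> `|r - r'| < delta ->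
    orbit_cvg H f r l -> orbit_cvg H f r' l' -> q (l - l') <= e.
Proof.
move=> qs e0; have e3 : 0 < e / 3 by rewrite divr_gt0.
have [d d0 dP] := orbit_equicontinuous p_generates FE F_dense f S qs e3.
exists (d / 2); first by rewrite divr_gt0.
move=> H r r' l l' H0 /andP[r0 rS] /andP[r'0 r'S] rr' fl fl'.
have [eta1 eta10 le1] := orbit_cvg_floor r0 fl qs e3.
have [eta2 eta20 le2] := orbit_cvg_floor r'0 fl' qs e3.
have [|h Hh] := H0 (Num.min (Num.min eta1 eta2) (d / 2)).
  by rewrite !lt_min eta10 eta20 divr_gt0.
rewrite !lt_min => /and3P[h0 /andP[h1 h2] h3].
have {}le1 := le1 h Hh ltac:(by rewrite h0).
have {}le2 := le2 h Hh ltac:(by rewrite h0).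
have [m1 m2] := truncn_step h0 r0; have [n1 n2] := truncn_step h0 r'0.
set m := Num.truncn (r / h) in le1 m1 m2; set n := Num.truncn _ in le2 n1 n2.
move: rr'; rewrite ltr_distl => rr'.
have := dP h m n; rewrite h0 ler_distl/=.
move=> /(_ ltac:(lra) ltac:(lra) ltac:(lra) ltac:(lra)) le3.
have le4 := seminormBD (sn qs) l (iter m (F h) f) l'.
have le5 := seminormBD (sn qs) (iter m (F h) f) (iter n (F h) f) l'.
rewrite (seminormBC (sn qs) l (iter _ _ _)) in le4; lra.
Qed.

Lemma orbit_cvg_unique (H : set R) f (s : R) l l' : hausdorff_space X ->
  arbitrarily_small H -> 0 <= s ->
  orbit_cvg H f s l -> orbit_cvg H f s l' -> l = l'.
Proof.
move=> hX H0 s0 fl fl'; apply: (hausdorff_csn p_generates hX) => q e qs e0.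
have [d d0 dP] := orbit_cvg_modulus s f qs e0.
by apply: (dP H s s) => //; rewrite ?s0 ?lexx// subrr normr0.
Qed.

Lemma orbit_cvg_bound (S : R) q : csn q -> exists2 q', csn q' &
  forall H f s l, arbitrarily_small H -> 0 <= s <= S ->
    orbit_cvg H f s l -> q l <= q' f.
Proof.
move=> qs; have [q' [q's _ leq']] := power_csn p_generates FE S qs.
exists q' => // H f s l H0 /andP[s0 sS] fl.
apply/ler_addgt0Pr => e e0.
have [eta eta0 le1] := orbit_cvg_floor s0 fl qs e0.
have [h Hh /[dup] heta /andP[h0 _]] := H0 _ eta0.
have {}le1 := le1 h Hh heta; have [m1 m2] := truncn_step h0 s0.
have le2 := leq' h (Num.truncn (s / h)) f h0 (le_trans m1 sS).
have := seminormBD (sn qs) l (iter (Num.truncn (s / h)) (F h) f) 0.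
rewrite !subr0 (seminormBC (sn qs) l); lra.
Qed.

Lemma orbit_cvg_linear (H : set R) (a : base_field R k) f f' (s : R) l l' :
  orbit_cvg H f s l -> orbit_cvg H f' s l' ->
  orbit_cvg H (a *: f + f') s (a *: l + l').
Proof.
move=> fl fl' q e qs e0.
have [c c0 qa] : exists2 c : R, 0 <= c & forall x, q (a *: x) = c * q x.
  have [x1 qx1] := norm_is_real a.
  exists x1; first by rewrite -(ler_to_scalar k) rmorph0 -qx1.
  move=> x; have [_ qZ] := sn qs; apply: (@to_scalar_inj R k).
  by rewrite qZ rmorphM/= qx1.
have e2 : 0 < e / 2 / (c + 1) by rewrite !divr_gt0// ltr_wpDl.
have e3 : 0 < e / 2 by rewrite divr_gt0.
have [eta eta0 le1] := fl q _ qs e2; have [eta' eta'0 le2] := fl' q _ qs e3.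
exists (Num.min eta eta'); first by rewrite lt_min eta0.
move=> h m Hh; rewrite !lt_min => /and3P[h0 h1 h2] /andP[m1 m2].
have {}le1 := le1 h m Hh ltac:(by rewrite h0) m1.
have {}le2 := le2 h m Hh ltac:(by rewrite h0) m2.
rewrite linearP opprD addrACA -scalerBr.
apply: le_trans (seminormD (sn qs) _ _) _; rewrite qa.
have : c * q (iter m (F h) f - l) <= e / 2.
  apply: (@le_trans _ _ ((c + 1) * (e / 2 / (c + 1)))); last first.
    by rewrite mulrC divfK// gt_eqF// ltr_wpDl.
  by apply: ler_pM => //; [exact: seminorm_ge0 (sn qs) _|rewrite lerDl].
lra.
Qed.

Lemma orbit_cvg_comp (H : set R) f (s r : R) v w : 0 <= s -> 0 <= r ->
  orbit_cvg H f s v -> orbit_cvg H v r w -> orbit_cvg H f (r + s) w.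
Proof.
move=> s0 r0 fv vw; apply: orbit_cvg_of => q e qs e0.
have e2 : 0 < e / 2 by rewrite divr_gt0.
have [q' [q's _ leq']] := power_csn p_generates FE r qs.
have [eta1 eta10 le1] := orbit_cvg_floor s0 fv q's e2.
have [eta2 eta20 le2] := orbit_cvg_floor r0 vw qs e2.
exists (Num.min eta1 eta2); first by rewrite lt_min eta10.
move=> h Hh; rewrite lt_min => /and3P[h0 h1 h2].
have {}le1 := le1 h Hh ltac:(by rewrite h0).
have {}le2 := le2 h Hh ltac:(by rewrite h0).
have [m1 m2] := truncn_step h0 s0; have [n1 n2] := truncn_step h0 r0.
set m := Num.truncn (s / h) in le1 m1 m2; set n := Num.truncn _ in le2 n1 n2.
exists (n + m)%N; first by rewrite natrD mulrDl ler_distl; lra.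
rewrite iterD; apply: le_trans (seminormBD (sn qs) _ (iter n (F h) v) _) _.
by rewrite -linearB/=; have := leq' h n (iter m (F h) f - v) h0 n1; lra.
Qed.

Lemma orbit_cvg0 (H : set R) f : orbit_cvg H f 0 f.
Proof.
apply: orbit_cvg_of => q e qs e0; exists 1 => // h _ /andP[h0 _].
exists 0%N; last by rewrite /= subrr (seminorm0 (sn qs)) ltW.
by rewrite mul0r subrr normr0 mulr_ge0// ltW.
Qed.

(** The derivative estimate passes to the limit in [h]. As [delta] precedes [H], it applies equally
    to limits along a subsequence and along all step sizes. *)
Lemma orbit_cvg_right_derivative (v g : X) q (e : R) :
  mef_closure F (v, g) -> csn q -> 0 < e ->
  exists2 delta, 0 < delta & forall d, 0 < d < delta ->
  forall H w, arbitrarily_small H -> orbit_cvg H v d w ->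
    q (w - v - iota d *: g) <= e * d.
Proof.
move=> vg qs e0; have e2 : 0 < e / 2 by rewrite divr_gt0.
have [delta delta0 deltaP] := orbit_derivative p_generates FE F_dense vg qs e2.
exists delta => // d /andP[d0 dd] H w H0 vw.
have [|eta1 eta10 le1] := deltaP d; first by rewrite d0 ltW.
have d4 : 0 < e / 4 * d by rewrite mulr_gt0// divr_gt0.
have [eta2 eta20 le2] := orbit_cvg_floor (ltW d0) vw qs d4.
have B0 : 0 < q g + 1 by apply: ltr_wpDl => //; exact: seminorm_ge0 (sn qs) _.
have [|h Hh] := H0 (Num.min (Num.min eta1 eta2) (e / 4 * d / (q g + 1))).
  by rewrite !lt_min eta10 eta20 divr_gt0.
rewrite !lt_min => /and3P[h0 /andP[h1 h2]]; rewrite ltr_pdivlMr// => h3.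
have [m1 m2] := truncn_step h0 (ltW d0).
set m := Num.truncn _ in m1 m2.
have {}le2 : q (iter m (F h) v - w) <= e / 4 * d by apply: le2; rewrite ?h0.
have {}le1 : q (iter m (F h) v - v - iota (m%:R * h) *: g) <= e / 2 * d.
  by apply: le1; rewrite ?h0.
have le3 : q (iota (m%:R * h) *: g - iota d *: g) <= e / 4 * d.
  rewrite -scalerBl -rmorphB (seminormZ (sn qs)).
  apply: le_trans (ltW h3); apply: ler_pM => //.
  - exact: seminorm_ge0 (sn qs) _.
  - by rewrite ler_norml; lra.
  - by rewrite lerDl.
have le4 := seminormBD (sn qs) (w - v) (iter m (F h) v - v) (iota d *: g).
have le5 := seminormBD (sn qs) (iter m (F h) v - v) (iota (m%:R * h) *: g) (iota d *: g).
rewrite (_ : w - v - (_ - v) = w - iter m (F h) v) in le4; last by rewrite opprB subrKA.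
rewrite (seminormBC (sn qs) w) in le4; lra.
Qed.

(** Limits on [A] and equicontinuity make the orbits of every [x] Cauchy at time [s]. Completeness
    is applied to the image of the filter of steps tending to 0, which requires no metrizability. *)
Lemma orbit_cvg_dense (A : set X) (s : R) : complete_space X -> 0 <= s ->
  dense A -> (forall f, A f -> exists l, orbit_cvg setT f s l) ->
  forall x, exists l, orbit_cvg setT x s l.
Proof.
move=> cX s0 dA Al x; pose y (h : R) := iter (Num.truncn (s / h)) (F h) x.
have y_cauchy q (e : R) : csn q -> 0 < e -> exists2 eta, 0 < eta &
    forall h h', 0 < h < eta -> 0 < h' < eta -> q (y h - y h') <= e.
  move=> qs e0; have e4 : 0 < e / 4 by rewrite divr_gt0.
  have [q' [q's _ leq']] := power_csn p_generates FE s qs.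
  have [f Af fx] := dense_csn p_generates x dA q's e4.
  have [l fl] := Al f Af.
  have [eta eta0 le] := orbit_cvg_floor s0 fl qs e4.
  have near_l h : 0 < h < eta -> q (y h - l) <= e / 2.
    move=> /[dup] heta /andP[h0 _]; have [m1 m2] := truncn_step h0 s0.
    apply: le_trans (seminormBD (sn qs) _
      (iter (Num.truncn (s / h)) (F h) f) _) _.
    rewrite /y -linearB/=; have := le h I heta.
    have := leq' h _ (x - f) h0 m1; rewrite (seminormBC (sn q's) x); lra.
  exists eta => // h h' hh /near_l h'l; have hl := near_l h hh.
  apply: le_trans (seminormBD (sn qs) _ l _) _.
  by rewrite (seminormBC (sn qs) l); lra.
have y_filter : ProperFilter (y @ 0^'+) by exact: fmap_proper_filter.
have [|l yl] := cX (y @ 0^'+) y_filter.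
  move=> E /(entourage_csnP p_generates)[q [e [qs e0 qE]]].
  have e2 : 0 < e / 2 by rewrite divr_gt0.
  have [eta eta0 etaP] := y_cauchy q _ qs e2.
  exists (y @` [set h | 0 < h < eta], y @` [set h | 0 < h < eta]).
    by split=> /=; apply/near_right0P; exists eta => // h heta; exists h.
  move=> [_ _] [/= [h hh <-] [h' hh' <-]]; apply: qE.
  by have := etaP h h' hh hh'; lra.
exists l; apply: orbit_cvg_of => q e qs e0.
have e2 : 0 < e / 2 by rewrite divr_gt0.
have [eta eta0 etaP] := y_cauchy q _ qs e2.
have [eta' eta'0 near_l] := (near_right0P _).1
  ((cvg_csnP p_generates _ _).1 yl q _ qs e2).
exists eta => // h _ /[dup] heta /andP[h0 h1].
have [m1 m2] := truncn_step h0 s0.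
exists (Num.truncn (s / h)); first by rewrite ler_distl; lra.
pose h' := Num.min eta eta' / 2.
have h'0 : 0 < h' by rewrite divr_gt0// lt_min eta0.
have [h'1 h'2] : h' < eta /\ h' < eta'.
  by apply/andP; rewrite -lt_min /h'; move: h'0; rewrite /h'; lra.
have := near_l h'; rewrite h'0 h'2 => /(_ isT) le1.
have := etaP h h' heta; rewrite h'0 h'1 => /(_ isT) le2.
apply: le_trans (seminormBD (sn qs) _ (y h') _) _; rewrite -/(y h); lra.
Qed.

End OrbitLimits.

(** * Hahn-Banach and weak limits *)

Section HahnBanach.
Context {R : realType} {k : scalar_kind} {V : tvsType (base_field R k)}.
Local Notation iota := (@to_scalar R k).
Variables (N : V -> R) (N_seminorm : is_seminorm N).

(* Partial functionals are represented by their graphs. Zorn's lemma is used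
   on a family containing the empty graph, hence the third condition. *)
Let dominated (z0 : V) (G : set (V * R)) :=
  [/\ forall (r : R) x y a b, G (x, a) -> G (y, b) ->
        G (iota r *: x + y, r * a + b),
      forall x a, G (x, a) -> a <= N x &
      G !=set0 -> G (z0, N z0)].

Let extension (x0 : V) (c : R) (G : set (V * R)) : set (V * R) :=
  [set z | exists x a r, [/\ G (x, a), z.1 = x + iota r *: x0 & z.2 = a + r * c]].

Let dominated_extension z0 x0 G : dominated z0 G -> G !=set0 ->
  exists c, dominated z0 (extension x0 c G).
Proof.
move=> [Glin GN Gz0] G0; have Gz := Gz0 G0.
(* The value [c] at [x0] must lie above all [a - N (x - x0)] and below all [N (y + x0) - b]; the
   supremum of the lower bounds is taken. *)
pose S := [set b | exists x a, G (x, a) /\ b = a - N (x - x0)].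
have Sle y b : G (y, b) -> ubound S (N (y + x0) - b).
  move=> Gy _ [x [a [Gx ->]]].
  have := GN _ _ (Glin 1 _ _ _ _ Gx Gy); rewrite rmorph1 scale1r mul1r.
  have := seminormD N_seminorm (x - x0) (y + x0).
  by rewrite addrACA addNr addr0; lra.
have supS : has_sup S.
  split; first by exists (N z0 - N (z0 - x0)), z0, (N z0).
  by exists (N (z0 + x0) - N z0); exact: Sle.
have Gscale r x a : G (x, a) -> G (iota r *: x, r * a).
  move=> Gx; have := Glin r _ _ _ _ Gx (Glin (-1) _ _ _ _ Gx Gx).
  by rewrite rmorphN1 scaleN1r addNr mulN1r addNr !addr0.
exists (sup S); split.
- move=> r x y a b [x1 [a1 [r1 [/= G1 -> ->]]]] [x2 [a2 [r2 [/= G2 -> ->]]]].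
  exists (iota r *: x1 + x2), (r * a1 + a2), (r * r1 + r2); split=> /=.
  + exact: Glin.
  + by rewrite scalerDr rmorphD rmorphM scalerDl scalerA addrACA.
  + by ring.
- move=> _ _ [x [a [r [/= Gx -> ->]]]].
  have [r0|r0|->] := ltgtP r 0; last first.
  + by rewrite rmorph0 scale0r mul0r !addr0; exact: GN.
  + have /(ge_sup supS.1) := Sle _ _ (Gscale r^-1 _ _ Gx).
    move=> /(ler_wpM2l (ltW r0)); rewrite mulrBr mulrA divff ?gt_eqF// mul1r.
    rewrite -[X in X * N _](gtr0_norm r0) -(seminormZ N_seminorm) scalerDr scalerA.
    by rewrite -rmorphM divff ?gt_eqF// rmorph1 scale1r; lra.
  + have S1 : S (- r^-1 * a - N (iota (- r^-1) *: x - x0)).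
      by exists (iota (- r^-1) *: x), (- r^-1 * a); split=> //; exact: Gscale.
    have nr0 : 0 < - r by lra.
    have := sup_upper_bound supS S1.
    move=> /(ler_wpM2l (ltW nr0)); rewrite mulrBr mulrA mulrNN divff ?lt_eqF// mul1r.
    rewrite -[X in X * N _](gtr0_norm nr0) -(seminormZ N_seminorm) scalerBr scalerA.
    rewrite -rmorphM mulrNN divff ?lt_eqF// rmorph1 scale1r rmorphN scaleNr opprK.
    lra.
- by move=> _; exists z0, (N z0), 0; rewrite rmorph0 scale0r mul0r !addr0; split.
Qed.

Lemma real_hahn_banach (z0 : V) : exists f : V -> R,
  [/\ forall r x y, f (iota r *: x + y) = r * f x + f y,
      forall x, f x <= N x & f z0 = N z0].
Proof.
have [G [[Glin GN Gz0] Gmax]] : exists G, dominated z0 G /\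
    forall G', G `<` G' -> ~ dominated z0 G'.
  apply: Zorn_bigcup => C Cdom Ctot; split.
  - move=> r x y a b [A CA Ax] [B CB By].
    have [AB|BA] := Ctot A B CA CB.
      by exists B => //; have [+ _ _] := Cdom B CB; apply => //; exact: AB.
    by exists A => //; have [+ _ _] := Cdom A CA; apply => //; exact: BA.
  - by move=> x a [A CA Ax]; have [_ + _] := Cdom A CA; apply.
  - by move=> [z [A CA Az]]; exists A => //; have [_ _] := Cdom A CA; apply; exists z.
have G0 : G !=set0.
  apply/set0P/eqP => G0.
  (* If the maximal graph were empty, the line through [z0] would be a strictly larger dominated
     graph. *)
  apply: (Gmax [set z | exists r, z.1 = iota r *: z0 /\ z.2 = r * N z0]).
    split; rewrite G0 // => /(_ (z0, N z0)); apply.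
    by exists 1; rewrite rmorph1 scale1r mul1r.
  split.
  - move=> r x y a b [r1 [/= -> ->]] [r2 [/= -> ->]]; exists (r * r1 + r2).
    by rewrite rmorphD rmorphM scalerDl scalerA; split => //=; ring.
  - move=> _ _ [r [/= -> ->]]; rewrite (seminormZ N_seminorm).
    by rewrite ler_wpM2r ?(seminorm_ge0 N_seminorm)// ler_norm.
  - by move=> _; exists 1; rewrite rmorph1 scale1r mul1r.
have Gz := Gz0 G0.
have G00 : G (0, 0).
  have := Glin (-1) _ _ _ _ Gz Gz.
  by rewrite rmorphN1 scaleN1r addNr mulN1r addNr.
have Gtot x0 : exists a, G (x0, a).
  apply: contrapT => nG.
  have [c Gc] := dominated_extension x0 (And3 Glin GN Gz0) G0.
  apply: Gmax Gc; split.
    by move=> [x a] Gx; exists x, a, 0; rewrite rmorph0 scale0r mul0r !addr0.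
  move=> /(_ (x0, c)) sub; apply: nG; exists c; apply: sub.
  by exists 0, 0, 1; rewrite rmorph1 scale1r mul1r !add0r.
have Guniq x a b : G (x, a) -> G (x, b) -> a = b.
  have le c d : G (x, c) -> G (x, d) -> c <= d.
    move=> Gc Gd; have := GN _ _ (Glin (-1) _ _ _ _ Gd Gc).
    by rewrite rmorphN1 scaleN1r addNr mulN1r (seminorm0 N_seminorm); lra.
  by move=> Ga Gb; apply: le_anti; rewrite !le.
have [f fG] := choice Gtot.
exists f; split.
- by move=> r x y; apply: (Guniq (iota r *: x + y)) => //; exact: Glin.
- by move=> x; exact: GN.
- exact: Guniq (fG z0) Gz.
Qed.

End HahnBanach.

(** In the complex case the functional is [f x - i f (i x)]. Its real and imaginary parts are each
    bounded by [N], so the factor 2 spares the rotation argument behind the sharp bound. Only the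
    value at [z0] serves for separation: its real part is [N z0]. *)
Lemma hahn_banach (R : realType) (k : scalar_kind) (V : tvsType (base_field R k))
    (N : V -> R) (z0 : V) : is_seminorm N ->
  exists phi : {linear V -> (base_field R k)^o},
    (forall x, `|phi x| <= to_scalar k (2 * N x)) /\
    (phi z0 = 0 -> N z0 = 0).
Proof.
move=> Ns; have [f [fL fN fz]] := real_hahn_banach Ns z0.
have f0 : f 0 = 0 by have := fL (-1) 0 0; rewrite scaler0 addr0; lra.
have fnorm x : `|f x| <= N x.
  rewrite ler_norml fN andbT lerNl -(seminormN Ns).
  have <- : f (- x) = - f x.
    by have := fL (-1) x 0; rewrite rmorphN1 scaleN1r !addr0 f0 addr0 mulN1r.
  exact: fN.
case: k V N z0 Ns f fL fN fz f0 fnorm => V N z0 Ns f fL fN fz f0 fnorm.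
  pose L := GRing.isLinear.Build R V R^o *:%R f fL.
  exists (HB.pack_for {linear V -> R^o} f L); split=> [x /=|]; last by rewrite -fz.
  by apply: le_trans (fnorm x) _; have := seminorm_ge0 Ns x; lra.
pose g (x : V) : R[i] := Complex (f x) (- f ('i%C *: x)).
have g_lin : linear (g : V -> R[i]^o).
  have fZ (r : R) x : f (r%:C%C *: x) = r * f x.
    by have := fL r x 0; rewrite !addr0 f0 addr0.
  have fD x y : f (x + y) = f x + f y.
    by have := fL 1 x y; rewrite rmorph1 scale1r mul1r.
  move=> [a b] x y; apply/eqP; rewrite eq_complex /=; apply/andP.
  have -> : Complex a b = a%:C%C + b%:C%C * 'i%C by simpc.
  split; apply/eqP.
    by rewrite fD scalerDl -scalerA fD !fZ; simpc; ring.
  rewrite scalerDr fD scalerA mulrDr scalerDl fD.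
  have -> : 'i%C * (b%:C%C * 'i%C) = (- b)%:C%C :> R[i] by simpc.
  by rewrite (mulrC 'i%C) -scalerA !fZ; simpc; ring.
pose L := GRing.isLinear.Build R[i] V R[i]^o *:%R g g_lin.
exists (HB.pack_for {linear V -> R[i]^o} g L); split=> [x /=|]; last first.
  by move=> [+ _]; rewrite fz.
rewrite normc_def lecR /=.
have iN : N ('i%C *: x) = N x.
  have [_ NZ] := Ns; apply: (@to_scalar_inj R complex_scalars).
  by rewrite NZ normc_def/= expr0n/= expr1n add0r sqrtr1 mul1r.
have N0 := seminorm_ge0 Ns x.
rewrite -(ger0_norm (_ : 0 <= 2 * N x)) ?mulr_ge0// -sqrtr_sqr ler_wsqrtr//.
have h1 := fnorm x; have h2 := fnorm ('i%C *: x); rewrite iN in h2.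
rewrite sqrrN -(real_normK (num_real (f x))) -(real_normK (num_real (f ('i%C *: x)))).
have := lerXn2r 2 (normr_ge0 _) N0 h1; have := lerXn2r 2 (normr_ge0 _) N0 h2.
by rewrite exprMn; have := sqr_ge0 (N x); lra.
Qed.

Section Weak.
Context {R : realType} {k : scalar_kind} {X : tvsType (base_field R k)}.
Local Notation K := (base_field R k).
Local Notation iota := (@to_scalar R k).
Context {Omega : Type} {p : Omega -> X -> R}.
Hypothesis p_generates : generating_seminorms p.
Local Notation csn := (continuous_seminorm p).
Local Notation sn := csn_seminorm.

Lemma weak_cvgP (u : nat -> X) (x : X) : weak_cvg u x <->
  forall phi : topological_dual (X := X), phi (u n) @[n --> \oo] --> (phi x : K^o).
Proof.
split=> [/cvg_sup ux phi|ux].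
  exact: cvg_comp (ux phi) (@initial_continuous X K^o (functional phi) x).
apply/cvg_sup => phi A [_ [[B oB <-] Bx BA]].
by apply: filterS BA _; apply: (ux phi); apply: open_nbhs_nbhs.
Qed.

Lemma cvg_weak (u : nat -> X) (x : X) : u @ \oo --> x -> weak_cvg u x.
Proof.
move=> ux; apply/weak_cvgP => phi.
exact: cvg_comp ux (functional_continuous (t := phi) (x := x)).
Qed.

Lemma weak_cvgB (u v : nat -> X) (x y : X) :
  weak_cvg u x -> weak_cvg v y -> weak_cvg (fun n => u n - v n) (x - y).
Proof.
move=> /weak_cvgP ux /weak_cvgP vy; apply/weak_cvgP => phi.
under eq_fun do rewrite linearB; rewrite linearB.
exact: cvgB (ux phi) (vy phi).
Qed.

Lemma dominated_continuous (phi : {linear X -> K^o}) q : csn q ->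
  (forall x, `|phi x| <= iota (q x)) -> continuous phi.
Proof.
move=> qs phiq x; apply/cvgrPdist_lt => e e0.
have [c ec] := norm_is_real e; rewrite gtr0_norm// in ec.
have c0 : 0 < c by rewrite -(ltr_to_scalar k) rmorph0 -ec.
have := nbhs_csn p_generates x qs c0; apply: filterS => y /= yx.
rewrite -linearB (le_lt_trans (phiq _))// ec ltr_to_scalar (seminormBC (sn qs)).
exact: yx.
Qed.

End Weak.

Section DistanceSeminorm.
Context {R : realType} {k : scalar_kind} {V : tvsType (base_field R k)}.
Local Notation iota := (@to_scalar R k).
Variables (q : V -> R) (G : set V).
Hypotheses (q_seminorm : is_seminorm q) (G_linear : linear_subspace G).

Definition distance_seminorm (x : V) : R := inf [set q (x - w) | w in G].
Local Notation D := distance_seminorm.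

Let lbound0 x : has_lbound [set q (x - w) | w in G].
Proof. by exists 0 => _ [w _ <-]; exact: seminorm_ge0. Qed.

Let nonempty x : [set q (x - w) | w in G] !=set0.
Proof. by exists (q (x - 0)), 0 => //; case: G_linear. Qed.

Lemma distance_le x w : G w -> D x <= q (x - w).
Proof. by move=> Gw; apply: ge_inf => //; exists w. Qed.

Lemma distance_ge x (c : R) : (forall w, G w -> c <= q (x - w)) -> c <= D x.
Proof. by move=> h; apply: lb_le_inf => // _ [w Gw <-]; exact: h. Qed.

Lemma distance_ge0 x : 0 <= D x.
Proof. by apply: distance_ge => w _; exact: seminorm_ge0. Qed.

Lemma distance_is_seminorm : is_seminorm D.
Proof.
have [G0 GL] := G_linear; split=> [x y|a x].
  apply/ler_addgt0Pr => e e0; have e2 : 0 < e / 2 by rewrite divr_gt0.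
  have [_ [v Gv <-] vx] := inf_adherent e2 (conj (nonempty x) (lbound0 x)).
  have [_ [w Gw <-] wy] := inf_adherent e2 (conj (nonempty y) (lbound0 y)).
  have Gvw : G (v + w) by rewrite -(scale1r v); exact: GL.
  have := distance_le (x + y) Gvw; rewrite opprD addrACA.
  have := seminormD q_seminorm (x - v) (y - w); rewrite /D; lra.
have [c ac] := norm_is_real a; have [_ qZ] := q_seminorm.
have Gscale b w : G w -> G (b *: w) by move=> Gw; rewrite -[_ *: _]addr0; exact: GL.
(* This inequality for every nonzero scalar also yields the reverse one, through the scalar [a^-1]
   and the vector [a *: x]. *)
have le b d z : `|b| = iota d -> b != 0 -> D (b *: z) <= d * D z.
  move=> bd b0; have d0 : 0 < d.
    by rewrite -(ltr_to_scalar k) rmorph0 -bd normr_gt0.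
  rewrite -ler_pdivrMl//; apply: distance_ge => w Gw.
  rewrite ler_pdivrMl//; apply: le_trans (distance_le _ (Gscale b w Gw)) _.
  rewrite -scalerBr -(ler_to_scalar k) qZ rmorphM/= bd lexx//.
have [->|a0] := eqVneq a 0.
  rewrite scale0r normr0 mul0r; suff -> : D 0 = 0 by rewrite rmorph0.
  apply/eqP; rewrite eq_le distance_ge0 andbT.
  by apply: le_trans (distance_le 0 G0) _; rewrite subr0 (seminorm0 q_seminorm).
rewrite ac -rmorphM/=; congr (iota _).
apply/eqP; rewrite eq_le le//=.
have c0 : 0 < c by rewrite -(ltr_to_scalar k) rmorph0 -ac normr_gt0.
have -> : D x = D (a^-1 *: (a *: x)) by rewrite scalerA mulVf// scale1r.
rewrite -ler_pdivlMl//; apply: le; last by rewrite invr_eq0.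
by rewrite normfV ac fmorphV.
Qed.

End DistanceSeminorm.

Section WeakClosure.
Context {R : realType} {k : scalar_kind} {X : tvsType (base_field R k)}.
Local Notation K := (base_field R k).
Local Notation iota := (@to_scalar R k).
Context {Omega : Type} {p : Omega -> X -> R}.
Hypothesis p_generates : generating_seminorms p.
Local Notation csn := (continuous_seminorm p).
Local Notation sn := csn_seminorm.

(* If [(x, y)] were outside the closure, Hahn-Banach applied to the distance
   to [G] would separate it from [G] by a functional
   [(v, w) |-> phi (v, 0) + phi (0, w)]. *)
Lemma weak_limit_closure (G : set (X * X)) (u v : nat -> X) (x y : X) :
  linear_subspace G -> (forall n, closure G (u n, v n)) ->
  weak_cvg u x -> weak_cvg v y -> closure G (x, y).
Proof.
move=> GL Guv ux vy; apply/(closure_prod_csnP p_generates) => q e qs e0.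
apply: contrapT => nclose.
pose q2 (z : X * X) := q z.1 + q z.2.
have q2s : is_seminorm q2.
  split=> [z w|a z]; rewrite /q2/=.
    by have := seminormD (sn qs) z.1 w.1; have := seminormD (sn qs) z.2 w.2; lra.
  by have [_ qZ] := sn qs; rewrite !rmorphD/= !qZ mulrDr.
have Ds := distance_is_seminorm q2s GL.
set D := distance_seminorm q2 G in Ds.
have Dxy : e <= D (x, y).
  apply: (distance_ge GL) => -[x' y'] Gxy; rewrite leNgt; apply/negP => lt_e.
  apply: nclose; exists x', y'; rewrite !(seminormBC (sn qs) _ x) !(seminormBC (sn qs) _ y).
  have := seminorm_ge0 (sn qs) (x - x'); have := seminorm_ge0 (sn qs) (y - y').
  by move: lt_e; rewrite /q2/= => *; split => //; lra.
(* The distance vanishes on the closure and not only on [G]; hence so does the functional it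
   dominates, which handles pairs [(u n, v n)] outside [G]. *)
have D0 z : closure G z -> D z = 0.
  case: z => z1 z2 Gz; apply/eqP; rewrite eq_le (distance_ge0 q2s GL) andbT.
  apply/ler_addgt0Pr => d d0; rewrite add0r.
  have [z1' [z2' [Gz' le1 le2]]] :=
    (closure_prod_csnP p_generates _ _ _).1 Gz q _ qs (divr_gt0 d0 (ltr0n R 2)).
  apply: le_trans (distance_le q2s _ Gz') _; rewrite /q2/=.
  by rewrite (seminormBC (sn qs) z1) (seminormBC (sn qs) z2); lra.
have [phi [phiD phi0]] := hahn_banach (x, y) Ds.
have D_le z : D z <= q2 z.
  by have := distance_le q2s z (proj1 GL); rewrite subr0.
have phi_q2 z : `|phi z| <= iota (2 * q2 z).
  by apply: le_trans (phiD z) _; rewrite ler_to_scalar ler_wpM2l.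
have aE a : a *: 0 + 0 = 0 :> X by rewrite scaler0 addr0.
pose f1 (w : X) : K^o := phi (w, 0); pose f2 (w : X) : K^o := phi (0, w).
have lin1 : linear f1.
  move=> a w w'; rewrite /f1 -[X in phi (_, X)](aE a).
  exact: linearP phi a (w, 0) (w', 0).
have lin2 : linear f2.
  move=> a w w'; rewrite /f2 -[X in phi (X, _)](aE a).
  exact: linearP phi a (0, w) (0, w').
pose L1 := GRing.isLinear.Build K X K^o *:%R f1 lin1.
pose L2 := GRing.isLinear.Build K X K^o *:%R f2 lin2.
pose phi1 : {linear X -> K^o} := HB.pack_for {linear X -> K^o} f1 L1.
pose phi2 : {linear X -> K^o} := HB.pack_for {linear X -> K^o} f2 L2.
have q'0 : csn (fun w => 2 * q w) by exact: csnZ.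
have phi1c : continuous phi1.
  apply: (dominated_continuous p_generates q'0) => w; have := phi_q2 (w, 0).
  by rewrite /q2/= (seminorm0 (sn qs)) addr0.
have phi2c : continuous phi2.
  apply: (dominated_continuous p_generates q'0) => w; have := phi_q2 (0, w).
  by rewrite /q2/= (seminorm0 (sn qs)) add0r.
have phiE w w' : phi (w, w') = phi1 w + phi2 w'.
  rewrite -[in LHS](addr0 w) -[in LHS](add0r w').
  exact: raddfD phi (w, 0) (0, w').
have u_cvg := (weak_cvgP u x).1 ux (TopologicalDual phi1c).
have v_cvg := (weak_cvgP v y).1 vy (TopologicalDual phi2c).
have uv_cvg : phi1 (u n) + phi2 (v n) @[n --> \oo] --> (phi1 x + phi2 y : K^o).
  exact: cvgD u_cvg v_cvg.
have : phi (x, y) = 0.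
  rewrite phiE; apply: (cvg_unique _ uv_cvg); first exact: norm_hausdorff.
  rewrite [X in X @ _](_ : _ = fun _ => 0); first exact: cvg_cst.
  apply/funext => n /=; rewrite -phiE; apply/eqP; rewrite -normr_le0.
  by apply: le_trans (phiD _) _; rewrite D0// mulr0 rmorph0.
by move=> /phi0 Dxy0; lra.
Qed.

End WeakClosure.

(** * Subsequences and diagonal extraction *)

Section Subsequences.
Implicit Types phi psi : nat -> nat.

Lemma increasing_ge phi : {homo phi : i j / (i < j)%N} -> forall n, (n <= phi n)%N.
Proof.
by move=> phi_incr; elim=> // n ih; apply: leq_ltn_trans ih _; exact: phi_incr.
Qed.

Lemma increasing_comp phi psi : {homo phi : i j / (i < j)%N} ->
  {homo psi : i j / (i < j)%N} -> {homo phi \o psi : i j / (i < j)%N}.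
Proof. by move=> hphi hpsi i j ij; exact/hphi/hpsi. Qed.

Lemma increasing_cvg phi : {homo phi : i j / (i < j)%N} -> phi @ \oo --> \oo.
Proof.
move=> hphi A [N _ NA]; exists N => // n /= Nn; apply: NA => /=.
exact: leq_trans Nn (increasing_ge hphi n).
Qed.

(** [P i] is not assumed stable under changing finitely many terms or thinning out. The conclusion
    instead exhibits a [phi_i] satisfying [P i] whose values, at indices at least [n], are those of
    the diagonal from [i] on; this suffices to transfer limits. *)
Lemma diagonal_subsequence (P : nat -> (nat -> nat) -> Prop) :
  (forall i phi, {homo phi : m n / (m < n)%N} ->
    exists2 psi, {homo psi : m n / (m < n)%N} & P i (phi \o psi)) ->
  exists2 phi, {homo phi : m n / (m < n)%N} &
    forall i, exists phi_i, P i phi_i /\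
      forall n, (i <= n)%N -> exists2 m, (n <= m)%N & phi n = phi_i m.
Proof.
move=> hP.
pose incr := {phi : nat -> nat | {homo phi : m n / (m < n)%N}}.
have /choice[step stepP] : forall z : nat * incr, exists s : incr,
    P z.1 (proj1_sig z.2 \o proj1_sig s).
  move=> [i [phi hphi]] /=; have [psi hpsi Ppsi] := hP i phi hphi.
  by exists (exist _ psi hpsi).
have id_incr : {homo id : m n / (m < n)%N} by [].
pose mk (phi : nat -> nat) (h : {homo phi : m n / (m < n)%N}) : incr :=
  exist _ phi h.
pose fix sub (i : nat) : incr := match i with
  | 0 => mk _ id_incr
  | i'.+1 => mk _ (increasing_comp (proj2_sig (sub i'))
      (proj2_sig (step (i', sub i'))))
  end.
have subS i : proj1_sig (sub i.+1) =
    proj1_sig (sub i) \o proj1_sig (step (i, sub i)) by [].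
have sub_le i j : exists2 psi, {homo psi : m n / (m < n)%N} &
    proj1_sig (sub (i + j)%N) = proj1_sig (sub i) \o psi.
  elim: j => [|j [psi hpsi E]]; first by exists id; rewrite ?addn0.
  exists (psi \o proj1_sig (step ((i + j)%N, sub (i + j)%N))).
    by apply: increasing_comp => //; apply: (proj2_sig (step _)).
  by rewrite addnS subS E.
(* The shift is due to [sub i.+1] being the stage built to satisfy [P i]. *)
exists (fun n => proj1_sig (sub n.+1) n).
  apply: homo_ltn => [a b c|n]; first exact: ltn_trans.
  rewrite [proj1_sig (sub n.+2)]subS /=; apply: (proj2_sig (sub n.+1)).
  exact: (increasing_ge (proj2_sig (step (n.+1, sub n.+1))) n.+1).
move=> i; exists (proj1_sig (sub i.+1)); split; first exact: (stepP (i, sub i)).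
move=> n ni; have [psi hpsi E] := sub_le i.+1 (n - i)%N.
rewrite addSn subnKC// in E.
by exists (psi n); [exact: increasing_ge|rewrite E].
Qed.

End Subsequences.

(** * Operators given by closed graphs *)

Section Closability.
Context {R : realType} {k : scalar_kind} {X : tvsType (base_field R k)}.
Context {Omega : Type} {p : Omega -> X -> R}.
Hypothesis p_generates : generating_seminorms p.

Lemma graph_linear (Z : linop X) : linear_subspace (graph Z).
Proof.
have [Z0 ZL] := dom_subspace Z; split.
  split => //=; have := app_linear (-1) Z0 Z0.
  by rewrite scaler0 addr0 scaleN1r addNr.
move=> a [x1 _] [x2 _] [/= D1 ->] [/= D2 ->]; split; first exact: ZL.
by rewrite /= app_linear.
Qed.

Lemma closure_linear (G : set (X * X)) :
  linear_subspace G -> linear_subspace (closure G).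
Proof.
move=> [G0 GL]; split; first exact: subset_closure.
move=> a [x y] [x' y'] /(closure_prod_csnP p_generates) Gxy.
move=> /(closure_prod_csnP p_generates) Gxy'.
apply/(closure_prod_csnP p_generates) => q e qs e0.
have [c ac] := norm_is_real a.
have c0 : 0 <= c by rewrite -(ler_to_scalar k) rmorph0 -ac.
have qa x0 : q (a *: x0) = c * q x0.
  have [_ qZ] := csn_seminorm qs; apply: (@to_scalar_inj R k).
  by rewrite qZ rmorphM/= ac.
have c1 : 0 < c + 1 by rewrite ltr_wpDl.
have e1 : 0 < e / 2 / (c + 1) by rewrite !divr_gt0.
have [u [v [Guv ux vy]]] := Gxy q _ qs e1.
have [u' [v' [Guv' ux' vy']]] := Gxy' q _ qs (divr_gt0 e0 (ltr0n R 2)).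
exists (a *: u + u'), (a *: v + v'); split; first exact: GL a _ _ Guv Guv'.
  rewrite opprD addrACA -scalerBr.
  apply: le_lt_trans (seminormD (csn_seminorm qs) _ _) _; rewrite qa.
  rewrite ltr_pdivlMr// mulrC in ux; have := seminorm_ge0 (csn_seminorm qs) (u - x).
  lra.
rewrite opprD addrACA -scalerBr.
apply: le_lt_trans (seminormD (csn_seminorm qs) _ _) _; rewrite qa.
rewrite ltr_pdivlMr// mulrC in vy; have := seminorm_ge0 (csn_seminorm qs) (v - y).
lra.
Qed.

Lemma linop_of_graph (G : set (X * X)) : linear_subspace G ->
  (forall y, G (0, y) -> y = 0) -> exists W : linop X, graph W = G.
Proof.
move=> [G0 GL] Guniq0.
have Guniq x y y' : G (x, y) -> G (x, y') -> y = y'.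
  move=> Gy Gy'; apply/eqP; rewrite -subr_eq0 addrC -scaleN1r; apply/eqP/Guniq0.
  have := GL (-1) _ _ Gy' Gy; rewrite -[_ + _]/(-1 *: x + x, -1 *: y' + y).
  by rewrite [-1 *: x]scaleN1r addNr.
pose D := [set x | exists y, G (x, y)].
pose f x := xget 0 [set y | G (x, y)].
have fP x : D x -> G (x, f x) by move=> Dx; exact: (xgetPex 0 Dx).
have D_linear : linear_subspace D.
  split; first by exists 0.
  by move=> a x y [x' Gx] [y' Gy]; exists (a *: x' + y'); exact: (GL a (x, x') (y, y')).
have f_linear a x y : D x -> D y -> f (a *: x + y) = a *: f x + f y.
  move=> Dx Dy; have Dxy := D_linear.2 a x y Dx Dy.
  by apply: Guniq (fP _ Dxy) _; exact: GL a _ _ (fP x Dx) (fP y Dy).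
exists (Linop D_linear f_linear); apply/seteqP; split=> -[x y] /=.
  by move=> [/= /fP Gx ->].
by move=> Gxy; have Dx : D x by [exists y]; split => //=; exact: Guniq (fP x Dx).
Qed.

Lemma graph_closure_op (Z : linop X) :
  closable Z -> graph (closure_op Z) = closure (graph Z).
Proof.
by rewrite /closure_op => cZ; case: pselect => // cZ'; exact: (projT2 (cid cZ')).
Qed.

End Closability.

(** * Limits of orbits from compactness *)

Section Compactness.
Context {R : realType} {k : scalar_kind} {X : tvsType (base_field R k)}.
Local Notation iota := (@to_scalar R k).
Context {Omega : Type} {p : Omega -> X -> R} {F : R -> {linear X -> X}}.
Hypothesis p_generates : generating_seminorms p.
Hypothesis FE : E_class p F.
Hypothesis F_dense : dense (mef_domain F).
Local Notation csn := (continuous_seminorm p).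
Local Notation sn := csn_seminorm.
Local Notation orbit_cvg := (@orbit_cvg R k X Omega p F).

(** A converse to [orbit_cvg_comp]: a limit curve along [H] is, from time [s] on, the limit of the
    orbit of its value [v]. The right derivative of the curve at [s] thus reduces to that of an
    orbit at time 0. *)
Lemma orbit_cvg_restart (H : set R) f (s d : R) v w : 0 <= s -> 0 <= d ->
  orbit_cvg H f s v -> orbit_cvg H f (d + s) w -> orbit_cvg H v d w.
Proof.
move=> s0 d0 fv fw; apply: (orbit_cvg_of p_generates FE F_dense) => q e qs e0.
have e2 : 0 < e / 2 by rewrite divr_gt0.
have [q' [q's _ leq']] := power_csn p_generates FE d qs.
have [eta1 eta10 le1] := orbit_cvg_floor s0 fv q's e2.
have [eta2 eta20 le2] := fw q _ qs e2.
exists (Num.min eta1 (eta2 / 2)); first by rewrite lt_min eta10 divr_gt0.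
move=> h Hh; rewrite lt_min => /and3P[h0 h1 h2].
have {}le1 := le1 h Hh ltac:(by rewrite h0).
have [m1 m2] := truncn_step h0 s0; have [n1 n2] := truncn_step h0 d0.
set m := Num.truncn (s / h) in le1 m1 m2; set n := Num.truncn _ in n1 n2.
exists n; first by rewrite ler_distl; lra.
have {le2} : q (iter (n + m) (F h) f - w) <= e / 2.
  apply: le2 => //; first by apply/andP; split; lra.
  by rewrite natrD mulrDl ltr_distl; lra.
have := leq' h n (v - iter m (F h) f) h0 n1; rewrite (seminormBC (sn q's)) linearB/=.
have := seminormBD (sn qs) (iter n (F h) v) (iter (n + m) (F h) f) w.
rewrite iterD; lra.
Qed.

(** This removes a further extraction that depends on [s]: the smaller set [H'] only supplies the
    candidate [l], while limits along [H] at nearby times and equicontinuity in time force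
    convergence along all of [H]. *)
Lemma orbit_cvg_dense_times (H H' : set R) f (s : R) l : 0 <= s ->
  H' `<=` H -> arbitrarily_small H' -> orbit_cvg H' f s l ->
  (forall d : R, 0 < d -> exists r w,
    [/\ 0 <= r, `|r - s| < d & orbit_cvg H f r w]) ->
  orbit_cvg H f s l.
Proof.
move=> s0 HH' H'0 fl fr; apply: (orbit_cvg_of p_generates FE F_dense) => q e qs e0.
have e3 : 0 < e / 3 by rewrite divr_gt0.
have [d1 d10 le1] := orbit_equicontinuous p_generates FE F_dense f (s + 1) qs e3.
have [d2 d20 le2] := orbit_cvg_modulus p_generates FE F_dense (s + 1) f qs e3.
have [|r [w [r0 rs fw]]] := fr (Num.min (Num.min d1 d2) 1 / 2).
  by rewrite divr_gt0// !lt_min d10 d20 ltr01.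
rewrite ltr_pdivlMr// !lt_min in rs; have /andP[/andP[rd1 rd2] r1] := rs.
rewrite -!ltr_pdivlMr// !ltr_distl in rd1 rd2 r1.
have wl : q (w - l) <= e / 3.
  apply: (le2 H' r s) => //; rewrite ?r0 ?s0/= ?ltr_distl; try lra.
  exact: orbit_cvg_sub fw.
have [eta eta0 le3] := orbit_cvg_floor r0 fw qs e3.
exists (Num.min eta (d1 / 2)); first by rewrite lt_min eta0 divr_gt0.
move=> h Hh; rewrite lt_min => /and3P[h0 h1 h2].
have {}le3 := le3 h Hh ltac:(by rewrite h0).
have [m1 m2] := truncn_step h0 s0; have [n1 n2] := truncn_step h0 r0.
set m := Num.truncn (r / h) in le3 n1 n2; set n := Num.truncn _ in m1 m2.
exists n; first by rewrite ler_distl; lra.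
have := le1 h n m; rewrite h0 ler_distl/=.
move=> le; have {le} le4 : q (iter n (F h) f - iter m (F h) f) <= e / 3.
  by clear -p_generates FE F_dense le m1 m2 n1 n2 r1 rd1 h0 h1 h2; apply: le; lra.
have := seminormBD (sn qs) (iter n (F h) f) (iter m (F h) f) l.
have := seminormBD (sn qs) (iter m (F h) f) w l.
clear -p_generates FE F_dense wl le3 le4; lra.
Qed.

Lemma arbitrarily_small_range (t : R) phi : 0 < t -> {homo phi : i j / (i < j)%N} ->
  arbitrarily_small [set t / (phi n).+1%:R | n in setT].
Proof.
move=> t0 hphi eta eta0; have te : 0 <= t / eta by rewrite divr_ge0// ltW.
pose n := Num.truncn (t / eta); exists (t / (phi n).+1%:R); first by exists n.
rewrite divr_gt0//= ltr_pdivrMr// -ltr_pdivrMl// mulrC.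
have /andP[_ /lt_le_trans] := truncn_itv te; apply.
by rewrite ler_nat ltnS; exact: increasing_ge.
Qed.

Lemma orbit_cvg_subsequence (t : R) f (s : R) l phi :
  0 < t -> 0 <= s -> {homo phi : i j / (i < j)%N} ->
  iter (Num.truncn ((phi n).+1%:R * s / t)) (F (t / (phi n).+1%:R)) f
    @[n --> \oo] --> l ->
  orbit_cvg [set t / (phi n).+1%:R | n in setT] f s l.
Proof.
move=> t0 s0 hphi fl; apply: (orbit_cvg_of p_generates FE F_dense) => q e qs e0.
have [N _ leN] := (cvg_csnP p_generates _ _).1 fl q e qs e0.
exists (t / (phi N).+1%:R); first by rewrite divr_gt0.
move=> _ [n _ <-] /andP[h0 hN].
exists (Num.truncn ((phi n).+1%:R * s / t)).
  have -> : (phi n).+1%:R * s / t = s / (t / (phi n).+1%:R).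
    by rewrite invfM invrK; ring.
  have [] := truncn_step h0 s0; move: (t / _) (Num.truncn _) h0 {hN} => h m h0.
  by rewrite ler_distl; lra.
(* A step smaller than the one of index [N] has index at least [N], because [phi] is increasing. *)
apply/ltW/leN => /=; rewrite leqNgt; apply/negP => /hphi phi_lt.
suff : t / (phi N).+1%:R < t / (phi n).+1%:R.
  by move=> /(lt_trans hN); rewrite ltxx.
by rewrite ltr_pM2l// ltf_pV2 ?posrE// ltr_nat.
Qed.

(** A countable dense set of times for the diagonal argument. The absolute value makes every index a
    nonnegative time, and an index that decodes to no rational gives 0. *)
Let rational_time (i : nat) : R := `|ratr (odflt 0 (unpickle i))|.

Let rational_time_dense (s d : R) : 0 <= s -> 0 < d ->
  exists i, `|rational_time i - s| < d.
Proof.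
move=> s0 d0; have sd : s < s + d by rewrite ltrDl.
have [r] := rat_in_itvoo sd.
rewrite in_itv/= => /andP[sr rd].
exists (pickle r); rewrite /rational_time pickleK/= [`|ratr r|]ger0_norm.
  by rewrite ltr_distl rd andbT (le_lt_trans _ sr)// gerBl ltW.
exact/ltW/(le_lt_trans s0).
Qed.

Lemma compact_orbit_cvg (Z W : linop X) (t : R) (f : X) :
  hausdorff_space X -> 0 < t ->
  graph W = closure (graph Z) -> graph W `<=` mef_closure F ->
  (forall s : R, 0 <= s -> exists fs : nat -> X,
    [/\ forall n, dom W (fs n),
        weak_cvg (fun n =>
          iter (Num.truncn (n.+1%:R * s)) (F (t / n.+1%:R)) f - fs n) 0,
        forall v, subsequence (fun n =>
            iter (Num.truncn (n.+1%:R * s / t)) (F (t / n.+1%:R)) f) v ->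
          exists w (l : X), subsequence v w /\ w @ \oo --> l &
        forall v, subsequence (fun n => W (fs n)) v ->
          exists w (l : X), subsequence v w /\ weak_cvg w l]) ->
  forall s : R, 0 <= s -> exists2 l, dom W l & orbit_cvg setT f s l.
Proof.
move=> hX t0 WZ WF fs_ex.
pose y (s : R) n := iter (Num.truncn (n.+1%:R * s / t)) (F (t / n.+1%:R)) f.
have y_compact (s : R) phi : 0 <= s -> {homo phi : m n / (m < n)%N} ->
    exists2 psi, {homo psi : m n / (m < n)%N} &
      exists l : X, y s (phi (psi n)) @[n --> \oo] --> l.
  move=> s0 hphi; have [fs [_ _ + _]] := fs_ex s s0.
  move=> /(_ (y s \o phi)) [|_ [l [[psi hpsi ->] yl]]]; first by exists phi.
  by exists psi => //; exists l.
have y_dom (s : R) phi l : 0 <= s -> {homo phi : m n / (m < n)%N} ->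
    y s (phi n) @[n --> \oo] --> l -> dom W l.
  move=> s0 hphi yl.
  (* At time [s / t], conditions (a) and (c) concern the powers
     [F (t / n) ^ [n s / t]], which are those of (b) at time [s]. *)
  have [fs [fsD fsy _ Wfs]] := fs_ex (s / t) (divr_ge0 s0 (ltW t0)).
  have [|_ [g [[psi hpsi ->] Wg]]] := Wfs ((W \o fs) \o phi); first by exists phi.
  have hchi := increasing_comp hphi hpsi.
  have weak_sub (u : nat -> X) x chi : {homo chi : m n / (m < n)%N} ->
      weak_cvg u x -> weak_cvg (u \o chi) x.
    move=> /increasing_cvg chi_cvg /weak_cvgP ux; apply/weak_cvgP => r.
    exact: cvg_comp chi_cvg (ux r).
  have fsl : weak_cvg (fs \o (phi \o psi)) l.
    have yl' : weak_cvg (y s \o phi \o psi) l.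
      by apply: weak_sub => //; exact: cvg_weak.
    have := weak_cvgB yl' (weak_sub _ _ _ hchi fsy); rewrite subr0.
    congr (weak_cvg _ l); apply/funext => n /=.
    by rewrite /y mulrA opprB addrCA subrr addr0.
  have /(weak_limit_closure p_generates (G := graph Z)) :
      forall n, closure (graph Z) (fs (phi (psi n)), W (fs (phi (psi n)))).
    by move=> n; rewrite -WZ; split => //; exact: fsD.
  by move=> /(_ _ _ (graph_linear Z) fsl Wg); rewrite -WZ => -[].
(* Condition (b) selects a subsequence for each time separately; the diagonal provides one for all
   rational times. *)
have [phi hphi phiP] := @diagonal_subsequence
  (fun i phi => exists l : X, y (rational_time i) (phi n) @[n --> \oo] --> l)
  (fun i phi => y_compact (rational_time i) phi (normr_ge0 _)).
pose H := [set t / (phi n).+1%:R | n in setT].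
have H0 : arbitrarily_small H by exact: arbitrarily_small_range.
have H_rational i : exists l, orbit_cvg H f (rational_time i) l.
  have [phi_i [[l phi_il] phiE]] := phiP i.
  exists l; apply: orbit_cvg_subsequence => //; first exact: normr_ge0.
  apply/(cvg_csnP p_generates) => q e qs e0.
  have [N _ leN] := (cvg_csnP p_generates _ _).1 phi_il q e qs e0.
  exists (maxn i N) => // n /=; rewrite geq_max => /andP[ni nN].
  have [m nm ->] := phiE n ni; apply: leN => /=; exact: leq_trans nm.
(* At a real time (b) extracts once more from [phi]; the limit lies in the domain by [y_dom] and
   holds along the whole of [H] by the limits at rational times. The value 0 at negative times is a
   placeholder. *)
have H_real (s : R) : exists l, 0 <= s -> dom W l /\ orbit_cvg H f s l.
  have [s0|] := leP 0 s; last by exists 0.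
  have [psi hpsi [l yl]] := y_compact s phi s0 hphi.
  have hchi := increasing_comp hphi hpsi.
  exists l => _; split; first exact: y_dom hchi yl.
  apply: (@orbit_cvg_dense_times _ [set t / ((phi \o psi) n).+1%:R | n in setT]) => //.
  - by move=> _ [n _ <-]; exists (psi n).
  - exact: arbitrarily_small_range.
  - exact: orbit_cvg_subsequence.
  - move=> d d0; have [i id] := rational_time_dense s0 d0.
    have [w fw] := H_rational i; exists (rational_time i), w; split => //.
    exact: normr_ge0.
have [u uP] := choice H_real.
have uD s : 0 <= s -> mef_closure F (u s, W (u s)).
  by move=> /uP[? _]; apply: WF.
have u0 : u 0 = f.
  have [_ fu] := uP 0 (lexx 0); apply: orbit_cvg_unique fu _ => //.
  exact: orbit_cvg0.
move=> s s0; exists (u s); first exact: (uP s s0).1.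
(* Here [H] is exchanged for all step sizes: the hypotheses on [u] follow from limits along [H]
   alone, whereas the conclusion concerns [setT]. *)
rewrite -u0; apply: (chernoff_trajectory p_generates FE F_dense uD) => //.
- move=> r q e r0 qs e0.
  have [d d0 dP] := orbit_cvg_right_derivative p_generates FE F_dense (uD r r0) qs e0.
  exists d => // c /[dup] cd /andP[c0 _]; apply: (dP c cd H) => //.
  apply: (@orbit_cvg_restart _ f) (ltW c0) (uP r r0).2 _ => //.
  by rewrite addrC; exact: (uP _ (addr_ge0 r0 (ltW c0))).2.
- move=> r q e r0 qs e0.
  have [d d0 dP] := orbit_cvg_modulus p_generates FE F_dense r f qs e0.
  exists d => // r' r'0 r'r; apply: (dP H r' r) => //.
  + by rewrite r'0/=; lra.
  + by rewrite lexx ltW.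
  + by rewrite ltr_distl; lra.
  + exact: (uP r' r'0).2.
  + exact: (uP r (ltW r0)).2.
Qed.

End Compactness.

(** * The limit semigroup *)

Section Semigroups.
Context {R : realType} {k : scalar_kind} {X : tvsType (base_field R k)}.
Local Notation K := (base_field R k).
Local Notation iota := (@to_scalar R k).
Context {Omega : Type} {p : Omega -> X -> R} {F : R -> {linear X -> X}}.
Hypothesis p_generates : generating_seminorms p.
Hypothesis FE : E_class p F.
Hypothesis F_dense : dense (mef_domain F).
Local Notation csn := (continuous_seminorm p).
Local Notation sn := csn_seminorm.
Local Notation orbit_cvg := (@orbit_cvg R k X Omega p F).
Implicit Type T : R -> {linear X -> X}.

Lemma csn_equicontinuous (G : set (X -> X)) :
  (forall q, csn q -> exists2 q', csn q' & forall g x, G g -> q (g x) <= q' x) ->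
  equicontinuous_family p G.
Proof.
move=> hG alpha.
have [q' [_ [s [M [M0 leM]]]] leq'] := hG _ (csn_generating p_generates alpha).
(* The coefficients must be positive, while [M] may vanish. *)
exists [seq (a, M + 1) | a <- s]; split.
  by rewrite all_map; apply: sub_all (all_predT s) => a _ /=; rewrite ltr_wpDl.
move=> g x Gg; apply: le_trans (leq' g x Gg) _; apply: le_trans (leM x) _.
rewrite big_map -big_distrr ler_wpM2r ?lerDl// sumr_ge0// => a _.
exact: seminorm_ge0 (sn (csn_generating p_generates a)) _.
Qed.

Lemma csn_bounded_operator (g : X -> X) :
  (forall q, csn q -> exists2 q', csn q' & forall x, q (g x) <= q' x) ->
  bounded_operator p g.
Proof.
move=> hg B Bb alpha.
have [q' [_ [s [M [M0 leM]]]] leq'] := hg _ (csn_generating p_generates alpha).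
have [C leC] : exists C, forall x, B x -> \sum_(a <- s) p a x <= C.
  elim: s {leM} => [|a s [C leC]]; first by exists 0 => x _; rewrite big_nil.
  have [D leD] := Bb a; exists (D + C) => x Bx.
  by rewrite big_cons lerD ?leD ?leC.
exists (M * C) => _ [x Bx <-]; apply: le_trans (leq' x) _.
by apply: le_trans (leM x) _; rewrite ler_wpM2l ?leC.
Qed.

Lemma strong_continuityP T :
  {within [set s : R | 0 <= s],
    continuous ((fun s => (T s : X -> X)) : R -> {ptws X -> X})} <->
  forall x (s : R) q (e : R), 0 <= s -> csn q -> 0 < e ->
    exists2 d, 0 < d & forall r, 0 <= r -> `|s - r| < d -> q (T r x - T s x) < e.
Proof.
rewrite subspace_continuousP; split=> [Tc x s q e s0 qs e0|Tc s s0].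
  have /pointwise_cvgP/(_ x) := Tc s s0.
  move=> /(cvg_csnP p_generates (fun h : X -> X => h x))/(_ q e qs e0).
  move=> /(nbhs_ballP s)[d /= d0 dP]; exists d => // r r0 sr.
  exact: dP.
apply/pointwise_cvgP => x.
apply/(cvg_csnP p_generates (fun h : X -> X => h x)) => q e qs e0.
have [d d0 dP] := Tc x s q e s0 qs e0.
by apply/(nbhs_ballP s); exists d => //= r sr r0; exact: dP.
Qed.

Lemma derivative_cvgP (D : R -> X) (g : X) :
  (iota h)^-1 *: D h @[h --> 0^'+] --> g <->
  forall q (e : R), csn q -> 0 < e ->
    exists2 delta, 0 < delta & forall d, 0 < d < delta ->
      q (D d - iota d *: g) <= e * d.
Proof.
have scaleE q (d : R) : csn q -> 0 < d ->
    q (D d - iota d *: g) = d * q ((iota d)^-1 *: D d - g).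
  move=> qs d0; rewrite -[X in X * _](gtr0_norm d0) -(seminormZ (sn qs)).
  by rewrite scalerBr to_scalarV scalerA -rmorphM divff ?gt_eqF// rmorph1 scale1r.
rewrite (cvg_csnP p_generates); split=> hD q e qs e0.
  have [d d0 dP] := (near_right0P _).1 (hD q e qs e0).
  exists d => // c /[dup] cd /andP[c0 _].
  by rewrite scaleE// mulrC ler_wpM2r ?(ltW c0)// ltW// dP.
have [d d0 dP] := hD q _ qs (divr_gt0 e0 (ltr0n R 2)).
apply/near_right0P; exists d => // c /[dup] /dP {}dP /andP[c0 _].
rewrite scaleE// mulrC ler_pM2r// in dP; lra.
Qed.

Lemma E_class_csn T (S : R) q : E_class p T -> csn q ->
  exists2 q', csn q' & forall s x, 0 <= s <= S -> q (T s x) <= q' x.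
Proof.
move=> TE qs; have [q' [q's qq' leq']] := power_csn p_generates TE S qs.
have [_ T0 _] := TE.
exists q' => // s x /andP[]; rewrite le_eqVlt => /orP[/eqP <- _|s0 sS].
  by rewrite T0.
by apply: (leq' s 1%N) => //; rewrite mul1r.
Qed.

(** [T r] commutes with the difference quotients of the semigroup, so it maps the domain of the
    generator into itself and intertwines with [W]. The orbit of [f] is then a trajectory of [W];
    its left continuity comes from strong continuity. *)
Lemma generator_orbit_cvg T (W : linop X) (f : X) (s : R) :
  lC0_semigroup p T -> is_generator T W -> graph W `<=` mef_closure F ->
  dom W f -> 0 <= s -> dom W (T s f) /\ orbit_cvg setT f s (T s f).
Proof.
move=> [Tc T0 TD TE] TW WF Wf s0; have Tc' := (strong_continuityP T).1 Tc.
have generatorP v g : graph W (v, g) <-> forall q (e : R), csn q -> 0 < e ->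
    exists2 delta, 0 < delta & forall d, 0 < d < delta ->
      q (T d v - v - iota d *: g) <= e * d.
  by rewrite TW -derivative_cvgP.
have graphT r : 0 <= r -> graph W (T r f, T r (W f)).
  move=> r0; apply/generatorP => q e qs e0.
  have [q' q's leq'] := E_class_csn r TE qs.
  have [|d d0 dP] := (generatorP f (W f)).1 _ q' e q's e0; first by split.
  exists d => // c /[dup] /dP {}dP /andP[c0 _]; apply: le_trans dP.
  rewrite -TD ?(ltW c0)// [c + r]addrC TD ?(ltW c0)// -linearZ -!linearB/=.
  by apply: leq'; rewrite r0 lexx.
split; first by case: (graphT s s0).
have graphE r : 0 <= r -> graph W (T r f, W (T r f)).
  by move=> /graphT[].
rewrite -{1}(T0 f); apply: (chernoff_trajectory (u := fun r => T r f)
  (g := fun r => W (T r f)) p_generates FE F_dense) => //.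
- by move=> r r0; apply/WF/graphE.
- move=> r q e r0 qs e0.
  have [d d0 dP] := (generatorP _ _).1 (graphE r r0) q e qs e0.
  exists d => // c /[dup] /dP {}dP /andP[c0 _].
  by rewrite [r + c]addrC TD// ltW.
- move=> r q e r0 qs e0; have [d d0 dP] := Tc' f r q e (ltW r0) qs e0.
  exists d => // r' r'0 r'r; apply/ltW/dP => //.
  by rewrite ltr_distl; lra.
Qed.

Section OfOrbitLimits.
Hypothesis hX : hausdorff_space X.
Variable T : R -> {linear X -> X}.
Hypothesis FT : forall (s : R) x, 0 <= s -> orbit_cvg setT x s (T s x).
Local Notation acc := (@arbitrarily_smallT R).

Let Tuniq (s : R) x l : 0 <= s -> orbit_cvg setT x s l -> T s x = l.
Proof.
by move=> s0; apply: orbit_cvg_unique (FT x s0) => //; exact: arbitrarily_smallT.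
Qed.

Let T0 x : T 0 x = x.
Proof. by apply: Tuniq => //; exact: orbit_cvg0. Qed.

Let TD (l m : R) : 0 <= l -> 0 <= m -> forall x, T (l + m) x = T l (T m x).
Proof.
move=> l0 m0 x; apply: Tuniq; first exact: addr_ge0.
exact: (orbit_cvg_comp p_generates FE F_dense m0 l0 (FT x m0) (FT _ l0)).
Qed.

Let Titer (r : R) j x : 0 <= r -> T (j%:R * r) x = iter j (T r) x.
Proof.
move=> r0; elim: j => [|j ih]; first by rewrite mul0r T0.
by rewrite -natr1 mulrDl mul1r addrC TD ?mulr_ge0// ih.
Qed.

Lemma orbit_limit_E_class : E_class p T.
Proof.
split=> // s s0.
  apply: csn_bounded_operator => q qs.
  have [q' q's leq'] := orbit_cvg_bound p_generates FE s qs.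
  exists q' => // x; apply: (leq' setT _ s); last exact: FT.
    exact: arbitrarily_smallT.
  by rewrite s0 lexx.
apply: csn_equicontinuous => q qs.
have [q' q's leq'] := orbit_cvg_bound p_generates FE s qs.
exists q' => // _ x [n [m [d [n0 m0 d0 mds ->]]]].
have dn0 : 0 <= d / n%:R by rewrite divr_ge0.
rewrite -Titer//; apply: (leq' setT _ (m%:R * (d / n%:R))).
- exact: arbitrarily_smallT.
- by rewrite mulr_ge0//= mulrA.
- by apply: FT; rewrite mulr_ge0.
Qed.

Lemma orbit_limit_lC0 : lC0_semigroup p T.
Proof.
split => //; last exact: orbit_limit_E_class.
apply/strong_continuityP => x s q e s0 qs e0.
have e2 : 0 < e / 2 by rewrite divr_gt0.
have [d d0 dP] := orbit_cvg_modulus p_generates FE F_dense (s + 1) x qs e2.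
exists (Num.min d 1); first by rewrite lt_min d0 ltr01.
move=> r r0; rewrite lt_min => /andP[rd r1]; apply: (@le_lt_trans _ _ (e / 2)); last by lra.
apply: (dP setT r s _ _ _ _ _ _ (FT x r0) (FT x s0)); first exact: arbitrarily_smallT.
- by move: r1; rewrite ltr_distl r0/=; lra.
- by rewrite s0/=; lra.
- by rewrite distrC.
Qed.

Lemma orbit_limit_derivative v g q (e : R) : mef_closure F (v, g) ->
  csn q -> 0 < e -> exists2 delta, 0 < delta & forall d, 0 < d < delta ->
    q (T d v - v - iota d *: g) <= e * d.
Proof.
move=> vg qs e0.
have [d d0 dP] := orbit_cvg_right_derivative p_generates FE F_dense vg qs e0.
exists d => // c cd; apply: (dP c cd setT); first exact: arbitrarily_smallT.
by apply: FT; case/andP: cd => /ltW.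
Qed.

Variables (W : linop X) (A : set X).
Hypotheses (W_closed : closed (graph W)) (WF : graph W `<=` mef_closure F).
Hypotheses (A_dense : dense A) (A_dom : A `<=` dom W).
Hypothesis A_orbit : forall (s : R) f, 0 <= s -> A f -> dom W (T s f).

(** Both sides are the right derivative at time [s] of the orbit of [f]: one from the derivative
    estimate at [T s f], the other by applying [T s] to the estimate at [f]. *)
Let W_orbit (s : R) f : 0 <= s -> A f -> W (T s f) = T s (W f).
Proof.
move=> s0 Af; have WTf : graph W (T s f, W (T s f)) by split => //; exact: A_orbit.
have Wf : graph W (f, W f) by split => //; exact: A_dom.
apply: (hausdorff_csn p_generates hX) => q e qs e0.
have e2 : 0 < e / 2 by rewrite divr_gt0.
have [q' q's leq'] := orbit_cvg_bound p_generates FE s qs.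
have [d1 d10 le1] := orbit_limit_derivative (WF WTf) qs e2.
have [d2 d20 le2] := orbit_limit_derivative (WF Wf) q's e2.
pose d := Num.min d1 d2 / 2.
have d0 : 0 < d by rewrite divr_gt0// lt_min d10.
have [dd1 dd2] : d < d1 /\ d < d2.
  by apply/andP; rewrite -lt_min /d; move: d0; rewrite /d; lra.
have {}le1 := le1 d ltac:(by rewrite d0).
have {}le2 := le2 d ltac:(by rewrite d0).
have le3 : q (T s (T d f - f - iota d *: W f)) <= q' (T d f - f - iota d *: W f).
  apply: (leq' setT _ s); [exact: arbitrarily_smallT|by rewrite s0 lexx|exact: FT].
have le4 : q (iota d *: W (T s f) - iota d *: T s (W f)) <= e * d.
  rewrite 2!linearB linearZ/= -TD ?(ltW d0)// [s + d]addrC TD ?(ltW d0)// in le3.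
  have := seminormBD (sn qs) (iota d *: W (T s f)) (T d (T s f) - T s f)
    (iota d *: T s (W f)).
  rewrite (seminormBC (sn qs) (iota d *: W (T s f)) (T d _ - _)); lra.
rewrite -scalerBr (seminormZ (sn qs)) gtr0_norm// mulrC ler_pM2r// in le4.
Qed.

(* The Riemann sums [N^-1 sum_(j < N) T (j delta / N) x'], with [x'] in [A],
   belong to the domain of [W], approximate [x], and their images by [W]
   telescope to [(T delta x' - x') / delta]. *)
Lemma orbit_limit_generator : is_generator T W.
Proof.
apply/seteqP; split=> -[x g] /= => [Wxg|xg].
  apply/derivative_cvgP => q e qs e0; exact: orbit_limit_derivative (WF Wxg) qs e0.
apply: W_closed; apply/(closure_prod_csnP p_generates) => q e qs e0.
have [q' q's leq'] : exists2 q', csn q' &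
    forall s y, 0 <= s <= 1 -> q (T s y) <= q' y.
  have [q' q's leq'] := orbit_cvg_bound p_generates FE 1 qs.
  exists q' => // s y s1; apply: (leq' setT _ s) => //; first exact: arbitrarily_smallT.
  by apply: FT; case/andP: s1.
have qq' y : q y <= q' y by rewrite -{1}(T0 y) leq'// lexx ler01.
have e8 : 0 < e / 8 by rewrite divr_gt0.
have [d1 d10 le1] := orbit_cvg_modulus p_generates FE F_dense 1 x qs e8.
have [d2 d20 le2] := (derivative_cvgP _ _).1 xg q _ qs e8.
pose d := Num.min (Num.min d1 d2) 1 / 2.
have d0 : 0 < d by rewrite divr_gt0// !lt_min d10 d20 ltr01.
have /andP[/andP[dd1 dd2] dlt1] : (d < d1) && (d < d2) && (d < 1).
  by rewrite -!lt_min /d; move: d0; rewrite /d; lra.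
have {}le2 := le2 d ltac:(by rewrite d0).
(* The approximation must be small relative to [d], since the telescoped sum is divided by [d]. *)
have [x' Ax' x'x] := dense_csn p_generates x A_dense q's (mulr_gt0 e8 d0).
have Wx' : graph W (x', W x') by split => //; exact: A_dom.
have [d3 d30 le3] := orbit_limit_derivative (WF Wx') q's e8.
have dd30 : 0 <= d / d3 by rewrite divr_ge0// ltW.
(* With this many terms the mesh [r = d / N] is below [d3], where the derivative estimate at [x']
   holds. *)
pose N := (Num.truncn (d / d3)).+1.
pose r := d / N%:R.
have r0 : 0 < r by rewrite divr_gt0.
have rN : N%:R * r = d by rewrite /r mulrC divfK// pnatr_eq0.
have rd3 : r < d3.
  rewrite /r ltr_pdivrMr// mulrC -ltr_pdivrMr//.
  by have /andP[] := truncn_itv dd30.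
have jr (j : 'I_N) : 0 <= j%:R * r <= d.
  rewrite mulr_ge0 ?(ltW r0)//= -rN ler_wpM2r ?(ltW r0)// ler_nat ltnW//.
have {}le3 := le3 r ltac:(by rewrite r0).
pose y := \sum_(j < N) T (j%:R * r) x'.
have [W0 WL] := graph_linear W.
have Wy : graph W (y, \sum_(j < N) T (j%:R * r) (W x')).
  rewrite /y; elim/big_ind2: _ => [//|u v w z Wuv Wwz|j _].
    by have := WL 1 _ _ Wuv Wwz; rewrite scale1r.
  have /andP[j0 _] := jr j; split=> /=; [exact: A_orbit|by rewrite W_orbit].
have WZ (c : R) u v : graph W (u, v) -> graph W (iota c *: u, iota c *: v).
  by move=> Wuv; have := WL (iota c) _ _ Wuv W0; rewrite addr0.
have N0 : 0 < N%:R :> R by [].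
have averageE q0 v z : csn q0 ->
    q0 (iota N%:R^-1 *: v - z) = N%:R^-1 * q0 (v - iota N%:R *: z).
  move=> q0s; rewrite -[X in X * _]gtr0_norm ?invr_gt0// -(seminormZ (sn q0s)).
  by rewrite scalerBr scalerA -rmorphM mulVf ?gt_eqF// rmorph1 scale1r.
have sum_constE z : iota N%:R *: z = \sum_(j < N) z.
  by rewrite sumr_const card_ord rmorph_nat scaler_nat.
have sum_le (c : R) (u : 'I_N -> X) : (forall j, q (u j) <= c) ->
    N%:R^-1 * q (\sum_j u j) <= c.
  move=> uc; rewrite ler_pdivrMl// mulr_natl -[X in _ *+ X](card_ord N) -sumr_const.
  by apply: le_trans (seminorm_sum (sn qs) _ _) _; apply: ler_sum => j _.
exists (iota N%:R^-1 *: y), (iota N%:R^-1 *: \sum_(j < N) T (j%:R * r) (W x')).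
split; first exact: WZ.
  apply: (@le_lt_trans _ _ (e / 8 + e / 8)); last by lra.
  rewrite averageE// sum_constE /y -sumrB; apply: sum_le => j.
  have /andP[j0 jd] := jr j.
  apply: le_trans (seminormBD (sn qs) _ (T (j%:R * r) x) _) _; apply: lerD.
    rewrite -linearB/=; apply: le_trans (leq' _ _ _) _; first by rewrite j0/=; lra.
    apply/ltW/(lt_le_trans x'x); rewrite ger_pMr//; exact: ltW.
  rewrite -[X in _ - X]T0; apply: (le1 setT (j%:R * r) 0).
  - exact: arbitrarily_smallT.
  - by rewrite j0/=; lra.
  - by rewrite lexx ler01.
  - by rewrite subr0 ger0_norm//; lra.
  - exact: FT.
  - exact: FT.
rewrite averageE//.
have tele : T d x' - x' = \sum_(j < N) T (j%:R * r) (T r x' - x').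
  rewrite -rN Titer ?(ltW r0)// iter_subr.
  by apply: eq_bigr => j _; rewrite Titer// ltW.
pose S := \sum_(j < N) T (j%:R * r) (W x').
have le4 : N%:R^-1 * q (T d x' - x' - iota r *: S) <= e / 8 * r.
  rewrite tele /S scaler_sumr -sumrB; apply: sum_le => j.
  rewrite -linearZ -linearB/=; apply: le_trans le3; apply: leq'.
  by have /andP[-> jd] := jr j; lra.
have le5 : q (T d x' - x' - (T d x - x)) <= e / 4 * d.
  have -> : T d x' - x' - (T d x - x) = T d (x' - x) - (x' - x).
    by rewrite [T d (_ - _)]linearB/= !opprD !opprK addrACA.
  apply: le_trans (seminormB (sn qs) _ _) _.
  have := leq' d (x' - x) ltac:(by rewrite (ltW d0) (ltW dlt1)).
  have := qq' (x' - x); lra.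
have le6 := seminormBD (sn qs) (iota r *: S) (T d x' - x') (iota d *: g).
have le7 := seminormBD (sn qs) (T d x' - x') (T d x - x) (iota d *: g).
rewrite (seminormBC (sn qs) (iota r *: S) (T d x' - x')) in le6.
rewrite ler_pdivrMl// mulrCA rN in le4.
(* The share of the Riemann sum is [e / 8], that of replacing [x'] by [x] is [e / 4], and that of
   the difference quotient at [x] is [e / 8]. *)
have le8 : r * q (S - iota N%:R *: g) <= e / 2 * d.
  rewrite -[X in X * _](gtr0_norm r0) -(seminormZ (sn qs)) scalerBr scalerA.
  by rewrite -rmorphM (mulrC r) rN; lra.
apply: (@le_lt_trans _ _ (e / 2)); last by lra.
rewrite ler_pdivrMl// -(ler_pM2l r0); apply: le_trans le8 _.
by rewrite -rN; lra.
Qed.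

End OfOrbitLimits.

End Semigroups.

Section LimitOperators.
Context {R : realType} {k : scalar_kind} {X : tvsType (base_field R k)}.
Context {Omega : Type} {p : Omega -> X -> R} {F : R -> {linear X -> X}}.
Hypothesis p_generates : generating_seminorms p.
Hypothesis FE : E_class p F.
Hypothesis F_dense : dense (mef_domain F).
Local Notation orbit_cvg := (@orbit_cvg R k X Omega p F).

Lemma orbit_limit_operators : hausdorff_space X ->
  (forall x (s : R), 0 <= s -> exists l, orbit_cvg setT x s l) ->
  exists T : R -> {linear X -> X},
    forall (s : R) x, 0 <= s -> orbit_cvg setT x s (T s x).
Proof.
move=> hX Fl; have /choice[S SP] : forall s : R, exists S : {linear X -> X},
    0 <= s -> forall x, orbit_cvg setT x s (S x).
  (* Nothing is required at negative times, where [F 0] stands for any linear map. *)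
  move=> s; have [s0|_] := leP 0 s; last by exists (F 0).
  have /choice[f fP] : forall x, exists l, orbit_cvg setT x s l.
    by move=> x; exact: Fl.
  have f_linear : linear f.
    move=> a x y; apply: (orbit_cvg_unique p_generates FE F_dense hX _ s0 (fP _)).
      exact: arbitrarily_smallT.
    exact: orbit_cvg_linear (fP x) (fP y).
  by exists (HB.pack_for {linear X -> X} f (GRing.isLinear.Build
    (base_field R k) X X *:%R f f_linear)).
by exists S => s x s0; exact: SP.
Qed.

Lemma orbit_cvg_sequence (t : R) f (s : R) l : 0 < t -> 0 <= s ->
  orbit_cvg setT f s l ->
  iter (Num.truncn (n.+1%:R * s / t)) (F (t / n.+1%:R)) f @[n --> \oo] --> l.
Proof.
move=> t0 s0 fl; apply/(cvg_csnP p_generates) => q e qs e0.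
have [eta eta0 etaP] := orbit_cvg_floor s0 fl qs (divr_gt0 e0 (ltr0n R 2)).
have te : 0 <= t / eta by rewrite divr_ge0// ltW.
exists (Num.truncn (t / eta)) => // n /= Nn.
have h0 : 0 < t / n.+1%:R by rewrite divr_gt0.
apply: (@le_lt_trans _ _ (e / 2)); last by lra.
have -> : n.+1%:R * s / t = s / (t / n.+1%:R) by rewrite invfM invrK; ring.
apply: etaP => //; rewrite h0/= ltr_pdivrMr// -ltr_pdivrMl// mulrC.
by have /andP[_ /lt_le_trans] := truncn_itv te; apply; rewrite ler_nat.
Qed.

End LimitOperators.

Theorem theorem8p4 (R : realType) (k : scalar_kind)
    (X : tvsType (base_field R k))
    (Omega : Type) (p : Omega -> X -> R)
    (Z : linop X) (t : R) (F : R -> {linear X -> X}) :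
  hausdorff_space X -> complete_space X ->
  generating_seminorms p ->
  dense (dom Z) ->
  0 < t ->
  F_class p F ->
  dom Z `<=` mef_domain F ->
  (forall g, dom Z g -> ef_derivative F g = Z g) ->
  (closable Z /\
   exists T : R -> {linear X -> X},
     lC0_semigroup p T /\ is_generator T (closure_op Z))
  <->
  exists A : set X,
    [/\ linear_subspace A, dense A, A `<=` dom Z &
        forall (f : X) (s : R), A f -> 0 <= s ->
        exists fs : nat -> X, (* [fs n] is the term of index n + 1 *)
          [/\ forall n, dom (closure_op Z) (fs n),
              weak_cvg (fun n =>
                iter (Num.truncn (n.+1%:R * s)) (F (t / n.+1%:R)) f - fs n) 0,
              forall v, subsequence (fun n =>
                  iter (Num.truncn (n.+1%:R * s / t)) (F (t / n.+1%:R)) f) v ->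
                exists w (l : X), subsequence v w /\ w @ \oo --> l &
              forall v, subsequence (fun n => closure_op Z (fs n)) v ->
                exists w (l : X), subsequence v w /\ weak_cvg w l]].
Proof.
move=> hX cX p_generates Z_dense t0 [FE F_dense] Z_dom Z_ef.
have Z_mef : closure (graph Z) `<=` mef_closure F.
  (* By [Z_dom], the value chosen by [xget] is an actual derivative and not the default 0. *)
  apply: closure_subset => -[f g] [/= Df ->]; rewrite -Z_ef//.
  exact: (xgetPex 0 (Z_dom f Df)).
have Z_closable : closable Z.
  apply: linop_of_graph; first by apply: (closure_linear p_generates); exact: graph_linear.
  by move=> g /Z_mef; exact: (mef_closure0 p_generates FE F_dense hX).
set W := closure_op Z; have WZ := graph_closure_op Z_closable; rewrite -/W in WZ.
have WF : graph W `<=` mef_closure F by rewrite WZ.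
have ZW : dom Z `<=` dom W.
  by move=> f Df; have : graph W (f, Z f); [rewrite WZ; exact: subset_closure|case].
split=> [[_ [T [T_lC0 TW]]]|[A [A_linear A_dense AZ A_approx]]].
  have T_orbit f (s : R) : dom Z f -> 0 <= s ->
      dom W (T s f) /\ orbit_cvg p F setT f s (T s f).
    by move=> /ZW; exact: (generator_orbit_cvg p_generates FE F_dense T_lC0 TW WF).
  have y_cvg f (s : R) : dom Z f -> 0 <= s ->
      iter (Num.truncn (n.+1%:R * s / t)) (F (t / n.+1%:R)) f
        @[n --> \oo] --> T s f.
    move=> Df s0; apply: (orbit_cvg_sequence p_generates) => //.
    exact: (T_orbit f s Df s0).2.
  exists (dom Z); split => //; first exact: dom_subspace.
  (* Condition (a) performs about [n * s] steps of size [t / n], hence reaches time [t * s], whereas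
     (b) reaches time [s]. *)
  move=> f s Df s0; have ts0 : 0 <= t * s by rewrite mulr_ge0// ltW.
  exists (fun _ => T (t * s) f); split.
  - by move=> n; exact: (T_orbit f _ Df ts0).1.
  - rewrite -(subrr (T (t * s) f)); apply: weak_cvgB.
      apply: cvg_weak; have := y_cvg f (t * s) Df ts0.
      under eq_fun do rewrite (mulrC t) mulrA mulfK ?gt_eqF//.
      exact.
    by apply: cvg_weak; exact: cvg_cst.
  - move=> _ [phi hphi ->].
    exists (fun n => iter (Num.truncn ((phi n).+1%:R * s / t)) (F (t / (phi n).+1%:R)) f).
    exists (T s f); split; first by exists id.
    exact: cvg_comp (increasing_cvg hphi) (y_cvg f s Df s0).
  - move=> _ [phi hphi ->].
    exists (fun _ => W (T (t * s) f)), (W (T (t * s) f)); split; first by exists id.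
    by apply: cvg_weak; exact: cvg_cst.
split => //.
have A_orbit f (s : R) : A f -> 0 <= s -> exists2 l, dom W l & orbit_cvg p F setT f s l.
  move=> Af; apply: (compact_orbit_cvg p_generates FE F_dense hX t0 WZ WF).
  by move=> r r0; exact: A_approx.
have [|T TF] := orbit_limit_operators p_generates FE F_dense hX.
  move=> x s s0; apply: (orbit_cvg_dense p_generates FE F_dense cX s0 A_dense).
  by move=> f /A_orbit-/(_ s s0)[l _ fl]; exists l.
exists T; split; first exact: (orbit_limit_lC0 p_generates FE F_dense hX TF).
(* Beyond closedness, this needs the orbits of [A] to remain in the domain of [W]; by uniqueness of
   limits, they consist of the limit points that the compactness argument placed there. *)
apply: (orbit_limit_generator p_generates FE F_dense hX TF _ WF A_dense).
- by rewrite WZ; exact: closed_closure.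
- by move=> f /AZ/ZW.
- move=> s f s0 Af; have [l Wl fl] := A_orbit f s Af s0.
  rewrite (orbit_cvg_unique p_generates FE F_dense hX _ s0 (TF s f s0) fl)//.
  exact: arbitrarily_smallT.
Qed.
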